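(* Let $E|k$ be a tamely ramified finite extension of non-Archimedean local fields. Then $\mu_{tame}(E|k)$ is non-empty and is an equivalence class of $\sim_{E|k}$, and the following are equivalent: 1. $E$ is $k$-isomorphic to $K\otimes_kU$ with $K|k$ totally ramified and $U|k$ unramified; 2. $E$ contains an $e$-th root of some uniformizer of $k$; 3. $1\in\mu_{tame}(E|k)$; 4. there exist uniformizers $\pi_E$ of $E$ and $\pi_k$ of $k$ with $(\pi_E^e/\pi_k)^{(q_E-1)/\tilde e}\in1+\mathfrak p_E$; 5. for all uniformizers $\pi_E$ of $E$ and $\pi_k$ of $k$, $(\pi_E^e/\pi_k)^{(q_E-1)/\tilde e}\in1+\mathfrak p_E$.
   Context: $e=e(E|k)$, $f=f(E|k)$; $q=\#\kappa_k$, $q_E=\#\kappa_E$ are the residue field cardinalities; $\tilde e:=\gcd\big(\frac{q_E-1}{q-1},e\big)$. $\mu_i(E)$ is the set of $i$-th roots of unity in $E$. $\mu_{tame}(E|k):=\{x\in\mu_{q_E-1}(E):\ \exists$ a uniformizer $\pi_E$ of $E$ with $\pi_E^ex^{-1}\in o_k\}$. On $\mu_{q_E-1}(E)$ define $x\sim_{E|k}y$ iff $(x/y)^{(q_E-1)/\tilde e}=1$. *)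

(* Defs.v *)
From HB Require Import structures.
From mathcomp Require Import all_boot all_order all_algebra all_field.
Set Implicit Arguments. Unset Strict Implicit. Unset Printing Implicit Defensive.
Import Order.TTheory GRing.Theory Num.Theory.
Local Open Scope ring_scope.

(* A (normalized) discrete valuation on a field R, given as v : R -> int;
   the value v 0 is irrelevant (conventionally +oo). *)
Definition discrete_valuation (R : fieldType) (v : R -> int) : Prop :=
  [/\ (forall x y : R, x != 0 -> y != 0 -> v (x * y) = v x + v y),
      (forall x y : R, x != 0 -> y != 0 -> x + y != 0 ->
          Num.min (v x) (v y) <= v (x + y))
    & (exists x : R, x != 0 /\ v x = 1)].

(* x \in p^n, i.e. x = 0 or v x >= n.  n = 0 : ring of integers o;
   n = 1 : maximal ideal p. *)
Definition vge (R : fieldType) (v : R -> int) (x : R) (n : int) : bool :=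
  (x == 0) || (n <= v x).

Definition uniformizer (R : fieldType) (v : R -> int) (x : R) : Prop :=
  x != 0 /\ v x = 1.

Definition v_cauchy (R : fieldType) (v : R -> int) (u : nat -> R) : Prop :=
  forall N : int, exists M : nat, forall m n : nat,
    (M <= m)%N -> (M <= n)%N -> vge v (u m - u n) N.
Definition v_converges (R : fieldType) (v : R -> int) (u : nat -> R) (l : R) : Prop :=
  forall N : int, exists M : nat, forall n : nat, (M <= n)%N -> vge v (u n - l) N.
Definition v_complete (R : fieldType) (v : R -> int) : Prop :=
  forall u : nat -> R, v_cauchy v u -> exists l, v_converges v u l.

(* The residue field o / p has exactly q elements: there is a complete
   system of q pairwise incongruent representatives in o. *)
Definition residue_card (R : fieldType) (v : R -> int) (q : nat) : Prop :=
  exists s : seq R,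
    [/\ size s = q,
        (forall x, x \in s -> vge v x 0),
        (forall i j : nat, (i < size s)%N -> (j < size s)%N -> i != j ->
            ~~ vge v (nth 0 s i - nth 0 s j) 1)
      & (forall x, vge v x 0 -> exists2 y, y \in s & vge v (x - y) 1)].

Definition nonarch_local_field (R : fieldType) (v : R -> int) (q : nat) : Prop :=
  [/\ discrete_valuation v, v_complete v & residue_card v q].

Definition ramif_index (k : fieldType) (E : fieldExtType k)
    (vk : k -> int) (vE : E -> int) (e : nat) : Prop :=
  (0 < e)%N /\ forall a : k, a != 0 -> vE (a%:A) = (e%:Z * vk a).

(* tamely ramified: the residue characteristic p (the prime with p%:R in p_k)
   does not divide e (residue field extensions of finite fields are separable). *)
Definition tamely_ramified (k : fieldType) (vk : k -> int) (e : nat) : Prop :=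
  forall p : nat, prime p -> vge vk (p%:R) 1 -> ~~ (p %| e)%N.

Definition mu (R : fieldType) (n : nat) (x : R) : Prop := x ^+ n = 1.

Definition etilde (q qE e : nat) : nat := gcdn ((qE - 1) %/ (q - 1)) e.

Definition mu_tame (k : fieldType) (E : fieldExtType k)
    (vk : k -> int) (vE : E -> int) (e qE : nat) (x : E) : Prop :=
  mu (qE - 1) x /\
  exists piE : E, uniformizer vE piE /\
    exists a : k, vge vk a 0 /\ piE ^+ e * x^-1 = a%:A.

Definition sim_Ek (E : fieldType) (q qE e : nat) (x y : E) : Prop :=
  (x / y) ^+ ((qE - 1) %/ etilde q qE e) = 1.

(* Subfield K of E (over k) totally ramified over k: f(K|k) = 1, i.e. every
   integral element of K is congruent mod p_E to an integral element of k. *)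
Definition totally_ramified_sub (k : fieldType) (E : fieldExtType k)
    (vk : k -> int) (vE : E -> int) (K : {subfield E}) : Prop :=
  forall x : E, x \in K -> vge vE x 0 ->
    exists a : k, vge vk a 0 /\ vge vE (x - a%:A) 1.

(* Subfield U of E (over k) unramified over k: e(U|k) = 1, i.e. the value
   group of U equals that of k. *)
Definition unramified_sub (k : fieldType) (E : fieldExtType k)
    (vE : E -> int) (U : {subfield E}) : Prop :=
  forall x : E, x \in U -> x != 0 -> exists a : k, a != 0 /\ vE x = vE (a%:A).

(* E is k-isomorphic to K (x)_k U via multiplication, for subfields K, U:
   the k-linear map K (x) U -> E, a (x) b |-> ab, is bijective, i.e. K U = E
   and [K:k][U:k] = [E:k]. *)
Definition tensor_decomposition (k : fieldType) (E : fieldExtType k)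
    (K U : {subfield E}) : Prop :=
  (K * U)%VS = fullv /\ (\dim K * \dim U)%N = \dim (fullv : {vspace E}).

(* Main.v *)
Require Import Defs.
From HB Require Import structures.
From mathcomp Require Import all_boot all_order all_algebra all_field.
From mathcomp Require Import cyclic zify ring.
From Stdlib Require Import Classical ClassicalEpsilon.
Set Implicit Arguments. Unset Strict Implicit. Unset Printing Implicit Defensive.
Import Order.TTheory GRing.Theory Num.Theory.
Local Open Scope ring_scope.

(** Since [e] is prime to the residue characteristic, Hensel's lemma makes the
    one-units of [E] divisible by [e] and splits every unit of [E] into a root of unity
    of order dividing [qE - 1] and a one-unit.  So [piE ^+ e / pik] may be corrected to
    a root of unity [x], which then lies in [mu_tame]; replacing [piE] and [pik] by other
    uniformizers multiplies [x] by [mu (qE - 1) ^ e] and by [mu (q - 1)], which together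
    generate the subgroup of index [etilde] of the cyclic group [mu (qE - 1)].  This
    gives the first claim and the equivalence of 2-5.

    1 => 2: by completeness, [U] has a [k]-basis whose residues are independent over
    the residue field of [k].  As [K] and [k] have the same residue field, the valuation
    of a [K]-combination of this basis is the least valuation of a coefficient; applied
    to a uniformizer of [E = K U], this yields a uniformizer of [E] in [K], and
    correcting it by a one-unit gives the root.
    2 => 1: take [K = k(p)] with [p ^+ e] a uniformizer of [k], and [U = k(z)] with [z]
    a Hensel lift of a generator of the residue field; the products of powers of [p]
    and [z] form a basis of [E]. *)

(** * Arithmetic of discrete valuations *)

Section Valuation.
Variables (R : fieldType) (v : R -> int).
Hypothesis dv : discrete_valuation v.

Lemma dvalM x y : x != 0 -> y != 0 -> v (x * y) = v x + v y.
Proof. by case: dv => h _ _; apply: h. Qed.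

Lemma dval1 : v 1 = 0.
Proof.
have h : v (1 * 1) = v 1 + v 1 by rewrite dvalM ?oner_neq0.
by rewrite mulr1 in h; lia.
Qed.

Lemma dvalN x : v (- x) = v x.
Proof.
have [->|x0] := eqVneq x 0; first by rewrite oppr0.
have N0 : (-1 : R) != 0 by rewrite oppr_eq0 oner_eq0.
have := dvalM N0 N0; rewrite mulrNN mulr1 dval1 => h.
by rewrite -mulN1r dvalM //; lia.
Qed.

Lemma dvalV x : x != 0 -> v x^-1 = - v x.
Proof.
move=> x0; have xV0 : x^-1 != 0 by rewrite invr_eq0.
by have := dvalM x0 xV0; rewrite mulfV // dval1; lia.
Qed.

Lemma dvalX x n : x != 0 -> v (x ^+ n) = n%:Z * v x.
Proof.
move=> x0; elim: n => [|n IH]; first by rewrite expr0 dval1 mul0r.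
by rewrite exprS dvalM ?expf_neq0 // IH; lia.
Qed.

Lemma dvalXz x (n : int) : x != 0 -> v (x ^ n) = n * v x.
Proof.
move=> x0; case: n => n; first by rewrite dvalX.
by rewrite NegzE -exprz_inv -exprnP dvalX ?invr_eq0 // dvalV // mulrN mulNr.
Qed.

Lemma vgeE x n : x != 0 -> vge v x n = (n <= v x).
Proof. by rewrite /vge => /negPf ->. Qed.

Lemma vge0 n : vge v 0 n.
Proof. by rewrite /vge eqxx. Qed.

Lemma vge_val x n : v x = n -> vge v x n.
Proof. by move=> <-; rewrite /vge lexx orbT. Qed.

Lemma vge_trans m n x : vge v x n -> m <= n -> vge v x m.
Proof.
by case/orP => [/eqP->|h hmn]; rewrite ?vge0 // /vge (le_trans hmn h) orbT.
Qed.

Lemma vgeD x y n : vge v x n -> vge v y n -> vge v (x + y) n.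
Proof.
have [->|x0] := eqVneq x 0; first by rewrite add0r.
have [->|y0] := eqVneq y 0; first by rewrite addr0.
have [->|xy0] := eqVneq (x + y) 0; first by rewrite vge0.
case: dv => _ /(_ x y x0 y0 xy0) h _; rewrite !vgeE //; lia.
Qed.

Lemma vgeN x n : vge v (- x) n = vge v x n.
Proof. by rewrite /vge oppr_eq0 dvalN. Qed.

Lemma vgeB x y n : vge v x n -> vge v y n -> vge v (x - y) n.
Proof. by move=> hx hy; apply: vgeD; rewrite ?vgeN. Qed.

Lemma vge_sym x y n : vge v (x - y) n = vge v (y - x) n.
Proof. by rewrite -vgeN opprB. Qed.

Lemma vgeM x y m n : vge v x m -> vge v y n -> vge v (x * y) (m + n).
Proof.
have [->|x0] := eqVneq x 0; first by rewrite mul0r !vge0.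
have [->|y0] := eqVneq y 0; first by rewrite mulr0 !vge0.
rewrite !vgeE ?mulf_neq0 // dvalM //; lia.
Qed.

Lemma vge_sum (I : Type) (r : seq I) (P : pred I) (F : I -> R) n :
  (forall i, P i -> vge v (F i) n) -> vge v (\sum_(i <- r | P i) F i) n.
Proof.
move=> h; apply: (big_ind (fun x => vge v x n)) => //; first exact: vge0.
by move=> x y; apply: vgeD.
Qed.

Lemma vge_eq0 x : (forall N : int, vge v x N) -> x = 0.
Proof.
move=> h; apply/eqP; apply: contraT => x0.
by have := h (v x + 1); rewrite vgeE //; lia.
Qed.

(** Strict ultrametric inequality: if [v y] were different, [x = y - (y - x)] would have valuation
    larger or smaller than [v x]. *)
Lemma dval_close x y : x != 0 -> vge v (y - x) (v x + 1) -> y != 0 /\ v y = v x.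
Proof.
move=> x0 h.
have y0 : y != 0.
  apply: contraTneq h => ->; rewrite sub0r vgeN vgeE //; lia.
split=> //; apply/eqP; rewrite eq_le; apply/andP; split; last first.
  rewrite -vgeE // -(subrK x y); apply: vgeD; last exact: vge_val.
  by apply: vge_trans h _; lia.
rewrite leNgt; apply/negP => hlt.
suff : vge v x (v x + 1) by rewrite vgeE //; lia.
rewrite -{1}(subKr y x); apply: vgeB => //; rewrite vgeE //; lia.
Qed.

Lemma vge1_unit x : vge v x 0 -> ~~ vge v x 1 -> x != 0 /\ v x = 0.
Proof.
move=> h0 h1; have x0 : x != 0 by apply: contraNneq h1 => ->; rewrite vge0.
by split=> //; move: h0 h1; rewrite !vgeE //; lia.
Qed.

Lemma vge_divr x y m n : y != 0 -> v y = m -> vge v x (m + n) -> vge v (x / y) n.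
Proof.
move=> y0 vy h; have -> : n = (m + n) - m by lia.
by apply: vgeM h _; apply: vge_val; rewrite dvalV // vy.
Qed.

End Valuation.

(* The proof argument makes the subring structure inferable. *)
Definition vint (R : fieldType) (v : R -> int) (dv : discrete_valuation v) :
  {pred R} := fun x => vge v x 0.

Fact vint_subring (R : fieldType) (v : R -> int) (dv : discrete_valuation v) :
  subring_closed (vint dv).
Proof.
split=> [|x y|x y]; rewrite -!topredE /=.
- by apply: vge_val; apply: dval1.
- exact: vgeB.
- by move=> hx hy; have := vgeM dv hx hy; rewrite addr0.
Qed.
HB.instance Definition _ (R : fieldType) (v : R -> int) (dv : discrete_valuation v) :=
  GRing.isSubringClosed.Build R (vint dv) (vint_subring dv).

Lemma vintE (R : fieldType) (v : R -> int) (dv : discrete_valuation v) x :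
  (x \in vint dv) = vge v x 0.
Proof. by []. Qed.

(** * The residue field, built on a system of representatives *)

Definition residue_system (R : fieldType) (v : R -> int) (s : seq R) : Prop :=
  [/\ (forall x, x \in s -> vge v x 0),
      (forall i j : nat, (i < size s)%N -> (j < size s)%N -> i != j ->
          ~~ vge v (nth 0 s i - nth 0 s j) 1)
    & (forall x, vge v x 0 -> exists2 y, y \in s & vge v (x - y) 1)].

(** The field o / p, carried by the indices of its representatives so that finiteness is immediate;
    the arguments [dv] and [hs] let the field structure be inferred. *)
Definition residue_field (R : fieldType) (v : R -> int)
  (dv : discrete_valuation v) (s : seq R) (hs : residue_system v s) : Type :=
  'I_(size s).

Section ResidueField.
Variables (R : fieldType) (v : R -> int) (dv : discrete_valuation v).
Variables (s : seq R) (hs : residue_system v s).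
Local Notation kappa := (residue_field dv hs).

HB.instance Definition _ := Finite.on kappa.

Fact residue_ltn x : vge v x 0 -> (find (fun y => vge v (x - y) 1) s < size s)%N.
Proof. by move=> h; rewrite -has_find; apply/hasP; case: hs => _ _; apply. Qed.

(** Outside the valuation ring the search fails and the value defaults to the class of 0. *)
Definition res (x : R) : kappa :=
  insubd (Ordinal (residue_ltn (vge0 v 0))) (find (fun y => vge v (x - y) 1) s).
Definition rep (i : kappa) : R := nth 0 s (nat_of_ord (i : 'I_(size s))).

Lemma rep_int i : vge v (rep i) 0.
Proof. by case: hs => h _ _; apply: h; rewrite mem_nth // ltn_ord. Qed.

Lemma rep_res x : vge v x 0 -> vge v (x - rep (res x)) 1.
Proof.
move=> hx; rewrite /rep /res val_insubd residue_ltn //.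
by apply: (@nth_find _ 0 (fun y => vge v (x - y) 1)); rewrite has_find residue_ltn.
Qed.

Lemma rep_inj (i j : kappa) : vge v (rep i - rep j) 1 -> i = j.
Proof.
move=> h; apply/eqP; apply: contraLR h => nij; case: hs => _ h _.
by apply: h; rewrite ?ltn_ord.
Qed.

Lemma resP x y : vge v x 0 -> vge v y 0 -> res x = res y <-> vge v (x - y) 1.
Proof.
move=> hx hy; have [rx ry] := (rep_res hx, rep_res hy); split=> [e|h].
  have -> : x - y = (x - rep (res x)) - (y - rep (res x)) by ring.
  by rewrite vgeB // e.
apply: rep_inj.
have -> : rep (res x) - rep (res y) = (x - y) - (x - rep (res x)) + (y - rep (res y)).
  by ring.
by rewrite vgeD // vgeB.
Qed.

Lemma repK : cancel rep res.
Proof. by move=> i; apply: rep_inj; rewrite (vge_sym dv) rep_res ?rep_int. Qed.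

Let addk (i j : kappa) := res (rep i + rep j).
Let oppk (i : kappa) := res (- rep i).
Let mulk (i j : kappa) := res (rep i * rep j).
Let invk (i : kappa) := if i == res 0 then i else res (rep i)^-1.

Let intD x y : vge v x 0 -> vge v y 0 -> vge v (x + y) 0.
Proof. by apply: (@rpredD _ (vint dv)). Qed.
Let intM x y : vge v x 0 -> vge v y 0 -> vge v (x * y) 0.
Proof. by apply: (@rpredM _ (vint dv)). Qed.
Let intN x : vge v x 0 -> vge v (- x) 0.
Proof. by rewrite vgeN. Qed.
Let int1 : vge v 1 0.
Proof. by apply: vge_val; apply: dval1. Qed.

Let addkE x y : vge v x 0 -> vge v y 0 -> addk (res x) (res y) = res (x + y).
Proof.
move=> hx hy; apply/resP; rewrite ?intD ?rep_int //.
have -> : rep (res x) + rep (res y) - (x + y) =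
  - ((x - rep (res x)) + (y - rep (res y))) by ring.
by rewrite vgeN // vgeD // rep_res.
Qed.
Let mulkE x y : vge v x 0 -> vge v y 0 -> mulk (res x) (res y) = res (x * y).
Proof.
move=> hx hy; apply/resP; rewrite ?intM ?rep_int //.
have -> : rep (res x) * rep (res y) - x * y =
  - ((x - rep (res x)) * rep (res y) + (y - rep (res y)) * x) by ring.
rewrite vgeN // vgeD //.
  by have := vgeM dv (rep_res hx) (rep_int (res y)); rewrite addr0.
by have := vgeM dv (rep_res hy) hx; rewrite addr0.
Qed.
Let oppkE x : vge v x 0 -> oppk (res x) = res (- x).
Proof.
move=> hx; apply/resP; rewrite ?intN ?rep_int // opprK addrC.
exact: rep_res.
Qed.

Fact res_addA : associative addk.
Proof.
move=> i j l; rewrite -[i]repK -[j]repK -[l]repK !addkE ?intD ?rep_int //.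
by rewrite addrA.
Qed.
Fact res_addC : commutative addk.
Proof. by move=> i j; rewrite /addk addrC. Qed.
Fact res_add0 : left_id (res 0) addk.
Proof. by move=> i; rewrite -[i]repK addkE ?rep_int ?vge0 // add0r. Qed.
Fact res_addN : left_inverse (res 0) oppk addk.
Proof. by move=> i; rewrite -[i]repK oppkE ?addkE ?intN ?rep_int // addNr. Qed.
HB.instance Definition _ := GRing.isZmodule.Build kappa
  res_addA res_addC res_add0 res_addN.

Fact res_mulA : associative mulk.
Proof.
move=> i j l; rewrite -[i]repK -[j]repK -[l]repK !mulkE ?intM ?rep_int //.
by rewrite mulrA.
Qed.
Fact res_mulC : commutative mulk.
Proof. by move=> i j; rewrite /mulk mulrC. Qed.
Fact res_mul1 : left_id (res 1) mulk.
Proof. by move=> i; rewrite -[i]repK mulkE ?rep_int // mul1r. Qed.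
Fact res_mulD : left_distributive mulk addk.
Proof.
move=> i j l; rewrite -[i]repK -[j]repK -[l]repK.
by rewrite !(addkE,mulkE) ?intM ?intD ?rep_int // mulrDl.
Qed.
Fact res_1neq0 : res 1 != res 0.
Proof.
apply/eqP => /resP; rewrite vge0 int1 subr0 => /(_ isT isT).
by rewrite vgeE ?oner_eq0 // dval1.
Qed.
HB.instance Definition _ := GRing.Zmodule_isComNzRing.Build kappa
  res_mulA res_mulC res_mul1 res_mulD res_1neq0.

Fact res_mulV (i : kappa) : i != 0 -> mulk (invk i) i = res 1.
Proof.
move=> i0; rewrite /invk (negPf (i0 : i != res 0)).
have [r0 vr] : rep i != 0 /\ v (rep i) = 0.
  apply: vge1_unit (rep_int i) _; apply: contra i0 => h; apply/eqP.
  by rewrite -[i]repK; apply/resP; rewrite ?rep_int ?vge0 ?subr0.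
rewrite -{2}[i]repK mulkE ?mulVf ?rep_int //.
by apply: vge_val; rewrite dvalV // vr oppr0.
Qed.
Fact res_inv0 : invk 0 = 0.
Proof. by rewrite /invk eqxx. Qed.
HB.instance Definition _ := GRing.ComNzRing_isField.Build kappa res_mulV res_inv0.

Lemma res1 : res 1 = 1.
Proof. by []. Qed.
Lemma resD x y : vge v x 0 -> vge v y 0 -> res (x + y) = res x + res y.
Proof. by move=> hx hy; rewrite -addkE. Qed.
Lemma resN x : vge v x 0 -> res (- x) = - res x.
Proof. by move=> hx; rewrite -oppkE. Qed.
Lemma resM x y : vge v x 0 -> vge v y 0 -> res (x * y) = res x * res y.
Proof. by move=> hx hy; rewrite -mulkE. Qed.
Lemma res_eq0 x : vge v x 0 -> (res x == 0) = vge v x 1.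
Proof.
by move=> hx; apply/eqP/idP => [|h]; last (apply/resP); rewrite ?vge0 ?subr0 //;
  move/resP; rewrite hx vge0 subr0; apply.
Qed.
Lemma res_eq1 x : vge v x 0 -> (res x == 1) = vge v (x - 1) 1.
Proof.
by move=> hx; apply/eqP/idP => [|h]; last (apply/resP); rewrite ?int1 //;
  move/resP; rewrite hx int1; apply.
Qed.
Lemma resX x n : vge v x 0 -> res (x ^+ n) = res x ^+ n.
Proof.
move=> hx; elim: n => [|n IH] //; rewrite !exprS resM ?IH //.
by apply: (@rpredX _ (vint dv)).
Qed.
Lemma res_nat n : res n%:R = n%:R.
Proof.
elim: n => [|n IH] //; rewrite -natr1 resD ?IH ?natr1 //.
by apply: (@rpred_nat _ (vint dv)).
Qed.
Lemma res_sum (I : Type) (r : seq I) (P : pred I) (F : I -> R) :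
  (forall i, P i -> vge v (F i) 0) ->
  res (\sum_(i <- r | P i) F i) = \sum_(i <- r | P i) res (F i).
Proof.
move=> h; suff [] : vge v (\sum_(i <- r | P i) F i) 0 /\
  res (\sum_(i <- r | P i) F i) = \sum_(i <- r | P i) res (F i) by [].
apply: (big_ind2 (fun x y => vge v x 0 /\ res x = y)) => //.
- by rewrite vge0.
- by move=> x _ y _ [hx <-] [hy <-]; rewrite resD // intD.
by move=> i /h.
Qed.

Lemma card_residue : #|{: kappa}| = size s.
Proof. exact: card_ord. Qed.

End ResidueField.

(** * Completeness, Hensel's lemma and one-units *)

Section Complete.
Variables (R : fieldType) (v : R -> int) (dv : discrete_valuation v).
Hypothesis cv : v_complete v.

Lemma vge_tail (u : nat -> R) n N : (forall i, (n <= i)%N -> vge v (u i.+1 - u i) N) ->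
  forall m, (n <= m)%N -> vge v (u m - u n) N.
Proof.
move=> h m /subnKC <-; elim: (m - n)%N => [|d IH]; first by rewrite addn0 subrr vge0.
rewrite addnS -(subrK (u (n + d)%N) (u _)) -addrA; apply: vgeD => //.
by apply: h; rewrite leq_addr.
Qed.

(** In an ultrametric, consecutive differences tending to 0 already make a sequence Cauchy. *)
Lemma complete_cvg (u : nat -> R) :
  (forall N, exists M, forall n, (M <= n)%N -> vge v (u n.+1 - u n) N) ->
  exists l, v_converges v u l.
Proof.
move=> h; apply: cv => N; have [M hM] := h N; exists M => m n hm hn.
rewrite -(subrK (u M) (u m)) -addrA; apply: vgeD => //; first exact: vge_tail.
by rewrite vge_sym //; apply: vge_tail.
Qed.

Lemma complete_lim (u : nat -> R) (c : int) :
  (forall n, vge v (u n.+1 - u n) (n%:Z + c)) ->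
  exists l, forall n, vge v (u n - l) (n%:Z + c).
Proof.
move=> h; have [|l hl] := @complete_cvg u.
  move=> N; exists (absz (N - c)) => n hn.
  by apply: (vge_trans (h n)); lia.
exists l => n; have [M hM] := hl (n%:Z + c).
rewrite -(subrK (u (n + M)%N) (u n)) -addrA; apply: vgeD => //.
  rewrite vge_sym //; apply: vge_tail; rewrite ?leq_addr // => i hi.
  by apply: (vge_trans (h i)); lia.
by apply: hM; rewrite leq_addl.
Qed.

Lemma horner_close (F : {poly R}) x h (n : int) :
  F \is a polyOver (vint dv) -> vge v x 0 -> vge v h n -> 0 <= n ->
  vge v (F.[x + h] - F.[x]) n /\ vge v (F.[x + h] - F.[x] - F^`().[x] * h) (n + n).
Proof.
move=> hF hx hh hn.
have hi i : vge v F^`N(i).[x] 0.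
  by apply: (@rpred_horner _ (vint dv)) => //; apply: polyOver_nderivn.
have hX i : vge v (h ^+ i) 0.
  by apply: (@rpredX _ (vint dv)); apply: vge_trans hh hn.
have hn1 i : vge v (F^`N(i).[x] * h) n.
  by rewrite -[n]add0r; apply: vgeM.
suff h2 : vge v (F.[x + h] - F.[x] - F^`().[x] * h) (n + n).
  split=> //; rewrite -(subrK (F^`().[x] * h) (_ - _)); apply: vgeD => //.
    by apply: vge_trans h2 _; lia.
  by rewrite -nderivn1.
rewrite (@nderiv_taylor_wide _ (size F).+2); [|exact: mulrC|by rewrite !leqW].
have e (a b c : R) : a + (b + c) - a - b = c by ring.
rewrite !big_ord_recl nderivn0 expr0 mulr1 /= nderivn1 expr1 e.
apply: vge_sum => // i _; rewrite !exprS mulrA; apply: vgeM => //.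
by rewrite -[n]addr0; apply: vgeM.
Qed.

(** Newton iteration. Convergence at linear speed suffices: the n-th iterate is a root modulo
    p^(n+1), and the derivative stays a unit along the way. *)
Lemma hensel (F : {poly R}) x0 :
  F \is a polyOver (vint dv) -> vge v x0 0 -> vge v F.[x0] 1 ->
  ~~ vge v F^`().[x0] 1 -> exists x, F.[x] = 0 /\ vge v (x - x0) 1.
Proof.
move=> hF hx0 hF0 hd0.
have hF' : F^`() \is a polyOver (vint dv) by apply: polyOver_deriv.
pose nt x := x - F.[x] / F^`().[x].
pose u n := iter n nt x0.
have good n : [/\ vge v (u n) 0, vge v F.[u n] (n%:Z + 1), ~~ vge v F^`().[u n] 1
               & vge v (u n.+1 - u n) (n%:Z + 1)].
  have step m x : vge v x 0 -> vge v F.[x] (m%:Z + 1) -> ~~ vge v F^`().[x] 1 ->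
      vge v (nt x - x) (m%:Z + 1).
    move=> hx h1 h2; rewrite /nt addrAC subrr add0r vgeN //.
    have [d0 vd] := vge1_unit (@rpred_horner _ (vint dv) _ _ hF' hx) h2.
    by apply: (vge_divr dv d0 vd); rewrite add0r.
  suff {n} good n : [/\ vge v (u n) 0, vge v F.[u n] (n%:Z + 1)
                     & ~~ vge v F^`().[u n] 1].
    by have [h1 h2 h3] := good n; split=> //; apply: step.
  elim: n => [|n [h1 h2 h3]]; first by split.
  have hs := step n _ h1 h2 h3; rewrite /u iterS -/(u n).
  have [d0 vd] := vge1_unit (@rpred_horner _ (vint dv) _ _ hF' h1) h3.
  have e : nt (u n) = u n + (nt (u n) - u n) by rewrite addrC subrK.
  have hn : (0 : int) <= n%:Z + 1 by clear; lia.
  split.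
  - by rewrite e; apply: vgeD => //; apply: vge_trans hs hn.
  (* The Newton correction cancels the value and the linear term, leaving a remainder in p^(2(n+1)),
     which is contained in p^(n+2). *)
  - have [_] := horner_close hF h1 hs hn; rewrite -e.
    rewrite {2}/nt [u n - _ - _]addrAC subrr add0r mulrN mulrCA mulfV // mulr1.
    by rewrite opprK subrK => h; apply: vge_trans h _; clear; lia.
  - have [h _] := horner_close hF' h1 hs hn; rewrite -e in h.
    have h' : vge v (F^`().[nt (u n)] - F^`().[u n]) (v F^`().[u n] + 1).
      by rewrite vd; apply: vge_trans h _; clear; lia.
    by have [z0 vz] := dval_close dv d0 h'; rewrite vgeE // vz vd.
have [l hl] := complete_lim (fun n => let: And4 _ _ _ h := good n in h).
exists l; split; last by rewrite vge_sym //; have := hl 0%N.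
have hli : vge v l 0.
  rewrite -(subKr (u 0%N) l); apply: vgeB => //.
  by apply: (vge_trans (hl 0%N)).
(* Both [F.[u n]] and [F.[l] - F.[u n]] lie in p^(n+1) for every n; taking n = |N| puts [F.[l]] in
   p^N. *)
apply: (@vge_eq0 _ v) => N; have [_ h _ _] := good `|N|%N.
have hn : (0 : int) <= `|N|%N%:Z + 1 by lia.
have [h2 _] := horner_close hF hli (hl `|N|%N) hn.
rewrite [l + _]addrC subrK in h2; rewrite -(subKr F.[u `|N|%N] F.[l]).
by apply: vgeB => //; [apply: vge_trans h _|apply: vge_trans h2 _]; lia.
Qed.

(** Hensel's lemma for X^n - x at the approximate root 1, where the derivative is the unit n. *)
Lemma one_unit_root n x : vge v (x - 1) 1 -> ~~ vge v n%:R 1 ->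
  exists2 t, t ^+ n = x & vge v (t - 1) 1.
Proof.
move=> hx hn.
have i1 : (1 : R) \in vint dv by apply: rpred1.
have ix : x \in vint dv.
  rewrite -(subrK 1 x) rpredD //; apply: vge_trans hx _; lia.
case: n hn => [|n hn]; first by rewrite vge0.
have [||||t [ht h]] := @hensel ('X^(n.+1) - x%:P) 1.
- by rewrite rpredB ?polyOverC ?rpredX ?polyOverX.
- by rewrite -(vintE dv).
- by rewrite !hornerE expr1n vge_sym.
- by rewrite derivB derivC subr0 derivXn hornerMn hornerXn expr1n.
exists t => //; move: ht; rewrite !hornerE => /eqP.
by rewrite subr_eq0 => /eqP.
Qed.

(** If [x] were not 1, then 1 + x + ... + x^(n-1) would vanish; but this sum is congruent to n, a
    unit. *)
Lemma root_unity_inj n x : ~~ vge v n%:R 1 -> x ^+ n = 1 -> vge v (x - 1) 1 -> x = 1.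
Proof.
move=> hn xn hx; apply/eqP; rewrite -subr_eq0; apply: contraNT hn => x1.
have ix : x \in vint dv.
  rewrite -(subrK 1 x) rpredD ?rpred1 //; apply: vge_trans hx _; lia.
have /eqP := subrX1 x n; rewrite xn subrr eq_sym mulf_eq0 (negPf x1) /= => /eqP s0.
rewrite -[n%:R]subr0 -[X in _ - X]s0 -{1}(card_ord n) -sumr_const -sumrB.
apply: vge_sum => // i _; rewrite -opprB vgeN // subrX1 -[1 : int]addr0; apply: vgeM => //.
by apply: (@rpred_sum _ (vint dv)) => j _; apply: rpredX.
Qed.

End Complete.

(** * Roots of unity and Teichmuller lifts in a local field *)

Section LocalField.
Variables (R : fieldType) (v : R -> int) (dv : discrete_valuation v).
Hypothesis cv : v_complete v.
Variables (s : seq R) (hs : residue_system v s).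
Local Notation kappa := (residue_field dv hs).
Local Notation res := (res dv hs).

Lemma res_unit_eq1 x : x != 0 -> v x = 0 -> vge v (x ^+ (size s - 1) - 1) 1.
Proof.
move=> x0 vx; have ix : vge v x 0 by apply: vge_val.
have ixn n : vge v (x ^+ n) 0 by apply: (@rpredX _ (vint dv)).
rewrite -(res_eq1 dv hs) // resX // -(card_residue dv hs) subn1.
rewrite -(inj_eq (mulfI (_ : res x != 0))); last by rewrite res_eq0 // vgeE // vx.
rewrite -exprS prednK ?mulr1; last by apply/card_gt0P; exists 0.
by rewrite expf_card.
Qed.

Lemma size_residue_gt1 : (1 < size s)%N.
Proof. by rewrite -(card_residue dv hs) card_finRing_gt1. Qed.

(** Translation by 1 permutes the residue field, so the sum of all its elements is unchanged when
    the cardinality is added to it. *)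
Lemma residue_card_nat : vge v (size s)%:R 1.
Proof.
rewrite -(res_eq0 dv hs) ?res_nat; last exact: (@rpred_nat _ (vint dv)).
have : \sum_(x : kappa) x = \sum_(x : kappa) (x + 1).
  by rewrite (reindex_inj (@addIr kappa 1)).
rewrite big_split /= -[LHS]addr0 => /addrI; rewrite sumr_const card_residue.
by move=> <-.
Qed.

Lemma natr_card1_unit : ~~ vge v (size s - 1)%:R 1.
Proof.
rewrite natrB ?(ltnW size_residue_gt1) //; apply/negP => h.
have : vge v ((size s)%:R - ((size s)%:R - 1)) 1 by apply: vgeB => //; apply: residue_card_nat.
by rewrite subKr vgeE ?oner_eq0 // dval1.
Qed.

(** Hensel's lemma for X^(q-1) - 1 at [x], with q = [size s]: the derivative (q-1) x^(q-2) is a unit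
    because q lies in p. *)
Lemma teichmuller x : x != 0 -> v x = 0 ->
  exists z, z ^+ (size s - 1) = 1 /\ vge v (z - x) 1.
Proof.
move=> x0 vx; have ix : x \in vint dv by apply: vge_val.
have hM := natr_card1_unit; have hx := res_unit_eq1 x0 vx.
case: (size s - 1)%N hM hx => [|M hM hx]; first by rewrite vge0.
have [||||z [hz h]] := @hensel _ _ dv cv ('X^(M.+1) - 1) x.
- by rewrite rpredB ?rpred1 ?rpredX ?polyOverX.
- by rewrite -(vintE dv).
- by rewrite !hornerE.
- rewrite derivB derivC subr0 derivXn hornerMn hornerXn -mulr_natl.
  apply: contra hM => hM; rewrite -(mulfK (expf_neq0 M x0) M.+1%:R).
  by apply: (vge_divr dv (m := 0)); rewrite ?expf_neq0 ?dvalX ?vx ?mulr0.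
by exists z; split=> //; move: hz; rewrite !hornerE => /eqP; rewrite subr_eq0 => /eqP.
Qed.

Lemma root_unity_unit n x : (0 < n)%N -> x ^+ n = 1 -> x != 0 /\ v x = 0.
Proof.
move=> n0 xn; have x0 : x != 0.
  by apply/eqP => x0; move: xn; rewrite x0 expr0n gtn_eqF // => /esym/eqP; rewrite oner_eq0.
split=> //; have := dvalX dv n x0; rewrite xn dval1 // => /esym/eqP.
by rewrite mulf_eq0 => /orP[|/eqP] //; lia.
Qed.

Lemma residue_prim_root : exists g : kappa, (size s - 1).-primitive_root g.
Proof.
have n0 : (0 < size s - 1)%N by have := size_residue_gt1; lia.
(* The nonzero residues are [size s - 1] distinct roots of unity of that order, enough to force a
   primitive one among them. *)
have := @has_prim_root _ (size s - 1) (rem 0 (enum {: kappa})) n0.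
case/(_ _ _ _)/hasP => [|||g _ hg]; last by exists g.
- apply/allP => x; rewrite mem_rem_uniq ?enum_uniq // => /andP[/= x0 _].
  apply/unity_rootP; rewrite -(card_residue dv hs) subn1; apply: (mulfI x0).
  rewrite -exprS prednK ?mulr1 ?expf_card //.
  by apply/card_gt0P; exists 0.
- by rewrite rem_uniq ?enum_uniq.
- by rewrite size_rem ?mem_enum // -cardE card_residue subn1.
Qed.

(** The order of [z] divides [n], and reducing [z] to [g] shows that it is also a multiple of the
    order [n] of [g]. *)
Lemma prim_root_lift g z n : (0 < n)%N ->
  n.-primitive_root g -> z ^+ n = 1 -> res z = g -> n.-primitive_root z.
Proof.
move=> n0 hg zn hz; have [z0 vz] := root_unity_unit n0 zn.
have [m hm hdm] := prim_order_exists n0 zn.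
suff -> : n = m by [].
apply/eqP; rewrite eqn_dvd hdm andbT (prim_order_dvd hg) -hz -resX ?vge_val //.
by rewrite (prim_expr_order hm) res1.
Qed.

Lemma local_prim_root : exists z : R, (size s - 1).-primitive_root z.
Proof.
have n0 : (0 < size s - 1)%N by have := size_residue_gt1; lia.
have [g hg] := residue_prim_root.
have ig := rep_int g.
have g0 : g != 0.
  apply/eqP => g0; have := prim_expr_order hg; rewrite g0 expr0n gtn_eqF //.
  by move/esym/eqP; rewrite oner_eq0.
have [r0 vr] : rep g != 0 /\ v (rep g) = 0.
  by apply: vge1_unit => //; rewrite -(res_eq0 dv hs) ?repK.
have [z [zn hz]] := teichmuller r0 vr.
exists z; apply: (prim_root_lift n0 hg zn); rewrite -[g]repK.
have [z0 vz] := root_unity_unit n0 zn.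
by apply/resP => //; apply: vge_val.
Qed.

End LocalField.

(** * Tame extensions: [mu_tame] as an equivalence class *)

Section Extension.
Variables (k : fieldType) (E : fieldExtType k) (vk : k -> int) (vE : E -> int).
Variables (dk : discrete_valuation vk) (dE : discrete_valuation vE).
Variable e : nat.
Hypothesis ram : ramif_index vk vE e.

Let e_gt0 : (0 < e)%N. Proof. by case: ram. Qed.

Lemma algA_eq0 (a : k) : (a%:A == 0 :> E) = (a == 0).
Proof. by rewrite scaler_eq0 oner_eq0 orbF. Qed.

Lemma algAV (a : k) : (a^-1)%:A = (a%:A)^-1 :> E.
Proof. by rewrite -!(in_algE E) fmorphV. Qed.

Lemma algAM (a b : k) : (a * b)%:A = a%:A * b%:A :> E.
Proof. by rewrite -!(in_algE E) rmorphM. Qed.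

Lemma dvalA a : a != 0 -> vE a%:A = e%:Z * vk a.
Proof. by case: ram => _; apply. Qed.

Lemma dvalZ a x : a != 0 -> x != 0 -> vE (a *: x) = e%:Z * vk a + vE x.
Proof.
by move=> a0 x0; rewrite -mulr_algl dvalM // ?algA_eq0 // dvalA.
Qed.

Lemma vgeA a n : vge vE a%:A (e%:Z * n) = vge vk a n.
Proof.
have [->|a0] := eqVneq a 0; first by rewrite scale0r !vge0.
by rewrite !vgeE ?algA_eq0 // dvalA // ler_pM2l //; lia.
Qed.

Lemma vgeA0 a : vge vE a%:A 0 = vge vk a 0.
Proof. by rewrite -vgeA mulr0. Qed.

Lemma vgeA1 a : vge vE a%:A 1 = vge vk a 1.
Proof.
have [->|a0] := eqVneq a 0; first by rewrite scale0r !vge0.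
rewrite !vgeE ?algA_eq0 // dvalA //; nia.
Qed.

Lemma uniformizerA a : a%:A != 0 :> E -> vE a%:A = e%:Z -> uniformizer vk a.
Proof.
rewrite algA_eq0 => a0; rewrite dvalA // => h; split=> //.
by move: h; case: (vk a) => n; nia.
Qed.

Section LocalExtension.
Hypotheses (ck : v_complete vk) (cE : v_complete vE).
Variables (sk : seq k) (hsk : residue_system vk sk).
Variables (sE : seq E) (hsE : residue_system vE sE).
Local Notation q := (size sk).
Local Notation qE := (size sE).
Local Notation resE := (res dE hsE).

(** The residue characteristic of [k] does not divide [e], so [e] is nonzero in the residue field of
    [k]; and p_E meets [k] in p_k. *)
Lemma tame_unit : tamely_ramified vk e -> ~~ vge vE e%:R 1.
Proof.
have [p pp hp] := finPcharP (residue_field dk hsk).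
have ik n : vge vk n%:R 0 by apply: (@rpred_nat _ (vint dk)).
move=> /(_ p pp); rewrite -(res_eq0 dk hsk) // res_nat -(dvdn_pcharf hp) dvdnn.
move=> /(_ isT); rewrite (dvdn_pcharf hp) -(res_nat dk hsk) res_eq0 // -vgeA1.
by rewrite scaler_nat.
Qed.

Let q1_gt0 : (0 < q - 1)%N.
Proof. by rewrite subn_gt0 (size_residue_gt1 dk hsk). Qed.
Let qE1_gt0 : (0 < qE - 1)%N.
Proof. by rewrite subn_gt0 (size_residue_gt1 dE hsE). Qed.

Lemma natr_q1_unit : ~~ vge vE (q - 1)%:R 1.
Proof. by rewrite -[(q - 1)%:R]scaler_nat vgeA1 natr_card1_unit. Qed.

Lemma prim_rootA : exists eta : k, (q - 1).-primitive_root (eta%:A : E).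
Proof.
have [eta h] := local_prim_root dk ck hsk; exists eta.
by rewrite -in_algE fmorph_primitive_root.
Qed.

(** A primitive root [eta] of order q - 1 from [k] satisfies eta^(qE-1) = 1, since this power is at
    once a one-unit and a root of unity of order prime to the residue characteristic. *)
Lemma dvdn_q1_qE1 : (q - 1 %| qE - 1)%N.
Proof.
have [eta h] := prim_rootA; rewrite (prim_order_dvd h); apply/eqP.
apply: (root_unity_inj dE natr_q1_unit).
  by rewrite exprAC (prim_expr_order h) expr1n.
have [z0 vz] := root_unity_unit dE q1_gt0 (prim_expr_order h).
exact: res_unit_eq1.
Qed.

Lemma root_unityA x : x ^+ (q - 1) = 1 -> exists c : k, [/\ c != 0, vk c = 0 & x = c%:A :> E].
Proof.
move=> xq; have [eta h] := prim_rootA; have [i ->] := prim_rootP h xq.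
have : eta ^+ (q - 1) = 1.
  apply: (fmorph_inj (in_alg E)); rewrite rmorphXn rmorph1 /=.
  exact: (prim_expr_order h).
case/(root_unity_unit dk q1_gt0) => e0 v0; exists (eta ^+ i).
by rewrite expf_neq0 // dvalX // v0 mulr0 -!in_algE rmorphXn.
Qed.

Local Notation et := (etilde q qE e).

(** Names the cofactors, so that later exponents become products free of division. *)
Lemma etilde_dec : exists a b : nat,
  [/\ (e = a * et)%N, (qE - 1 = b * et * (q - 1))%N,
      ((qE - 1) %/ et = b * (q - 1))%N & (0 < et)%N].
Proof.
have et0 : (0 < et)%N by rewrite gcdn_gt0 e_gt0 orbT.
have /dvdnP[a ha] : (et %| e)%N by apply: dvdn_gcdr.
have /dvdnP[b hb] : (et %| (qE - 1) %/ (q - 1))%N by apply: dvdn_gcdl.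
have hM : (qE - 1 = b * et * (q - 1))%N by rewrite -hb divnK // dvdn_q1_qE1.
by exists a, b; split=> //; rewrite {1}hM mulnAC mulnK.
Qed.

(** The exponent on [u] is a multiple of qE - 1 and the one on [c] a multiple of q - 1, so both
    factors have residue 1. *)
Lemma unit_power_etilde u c : u != 0 -> vE u = 0 -> c != 0 -> vk c = 0 ->
  vge vE ((u ^+ e * c%:A) ^+ ((qE - 1) %/ et) - 1) 1.
Proof.
move=> u0 vu c0 vc; have [a [b [ha hM hMe et0]]] := etilde_dec.
have iu n : vge vE (u ^+ n) 0 by apply: vge_val; rewrite dvalX // vu mulr0.
have ic n : vge vE (c%:A ^+ n) 0.
  by apply: vge_val; rewrite dvalX ?algA_eq0 // dvalA // vc !mulr0.
rewrite exprMn -!exprM hMe {1}ha.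
have -> : (a * et * (b * (q - 1)) = (qE - 1) * a)%N by rewrite hM; ring.
rewrite [(b * _)%N]mulnC.
rewrite -(res_eq1 dE hsE); last by apply: (@rpredM _ (vint dE)); [apply: iu|apply: ic].
rewrite resM // [u ^+ _]exprM [c%:A ^+ _]exprM.
rewrite (resX _ _ _ (iu _)) (resX _ _ _ (ic _)).
have /eqP -> : resE (u ^+ (qE - 1)) == 1 by rewrite res_eq1 // res_unit_eq1.
have /eqP -> : resE (c%:A ^+ (q - 1)) == 1.
  have hB : c%:A ^+ (q - 1) - 1 = (c ^+ (q - 1) - 1)%:A :> E.
    by rewrite -!in_algE rmorphB rmorphXn rmorph1.
  by rewrite res_eq1 // hB vgeA1; apply: res_unit_eq1.
by rewrite !expr1n mulr1.
Qed.

(* By Bezout, the subgroups mu(qE-1)^e and mu(q-1) of the cyclic group mu(qE-1)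
   generate its subgroup of index etilde. *)
Lemma root_unity_etilde z : z ^+ ((qE - 1) %/ et) = 1 ->
  exists u (c : k), [/\ u != 0, vE u = 0, c != 0, vk c = 0 & z = u ^+ e * c%:A].
Proof.
move=> hz; have [a [b [ha hM hMe et0]]] := etilde_dec.
have zM : z ^+ (qE - 1) = 1.
  by rewrite hM mulnAC exprM -hMe hz expr1n.
have [g hg] := local_prim_root dE cE hsE; have [[i /= _] hi] := prim_rootP hg zM.
(* With z = g^i and [g] primitive of order qE - 1, the hypothesis on [z] says exactly that [et]
   divides [i]. *)
have /dvdnP[j hj] : (et %| i)%N.
  have b0 : (0 < b * (q - 1))%N by move: qE1_gt0; rewrite hM mulnAC muln_gt0 => /andP[].
  rewrite -(dvdn_pmul2l b0) mulnAC -hM (prim_order_dvd hg) mulnC -hMe exprM.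
  by rewrite -hi hz.
have [g0 vg] := root_unity_unit dE qE1_gt0 (prim_expr_order hg).
(* Bezout: km e = kn (qE-1)/(q-1) + et. Hence g^(et j) is the e-th power of g^(km j) times the
   inverse of g^(kn j (qE-1)/(q-1)), a root of unity of order dividing q - 1 and so an element of
   [k]. *)
case: (egcdnP ((qE - 1) %/ (q - 1)) e_gt0) => km kn hb _.
rewrite gcdnC -/et in hb.
have hr : (g ^+ ((qE - 1) %/ (q - 1) * (kn * j)))^-1 ^+ (q - 1) = 1.
  rewrite -exprVn -!exprM mulnAC divnK ?dvdn_q1_qE1 // exprVn exprM.
  by rewrite (prim_expr_order hg) expr1n invr1.
have [c [c0 vc hc]] := root_unityA hr.
exists (g ^+ (km * j)), c; split; rewrite ?expf_neq0 ?dvalX ?vg ?mulr0 // -hc hi hj.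
rewrite -exprM mulnAC hb mulnDl exprD.
rewrite (_ : (kn * _ * j)%N = ((qE - 1) %/ (q - 1) * (kn * j))%N); last by ring.
by rewrite mulrAC mulfV ?mul1r ?expf_neq0 // mulnC.
Qed.

Hypothesis tame : tamely_ramified vk e.

(** Since [x] is a unit, the integral scalar in the definition has valuation [e] in [E], which makes
    it a uniformizer of [k]. *)
Lemma mu_tameP x : mu_tame vk vE e qE x <->
  mu (qE - 1) x /\ exists piE pik,
   [/\ uniformizer vE piE, uniformizer vk pik & piE ^+ e = x * pik%:A].
Proof.
split=> -[hx]; have [x0 vx] := root_unity_unit dE qE1_gt0 hx.
  case=> p [[p0 vp] [a [ia h]]]; split=> //.
  have hp : p ^+ e = x * a%:A by rewrite -h mulrC mulfVK.
  exists p, a; split=> //; apply: uniformizerA.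
    by rewrite -h mulf_neq0 ?invr_eq0 ?expf_neq0.
  by rewrite -h dvalM ?invr_eq0 ?expf_neq0 // dvalV // dvalX // vp vx mulr1 subr0.
case=> p [a [hp [a0 va] h]]; split=> //; exists p; split=> //; exists a.
by rewrite h [x * _]mulrC mulfK // vgeE // va.
Qed.

(** Take for [x] the Teichmuller lift of the unit w = piE^e / pik. Then w / x is a one-unit, hence
    some t^e, and piE / t witnesses membership. *)
Lemma mu_tame_approx piE pik : uniformizer vE piE -> uniformizer vk pik ->
  exists2 x, mu_tame vk vE e qE x & vge vE (piE ^+ e / pik%:A - x) 1.
Proof.
move=> [p0 vp] [a0 va].
have a0E : pik%:A != 0 :> E by rewrite algA_eq0.
set w := piE ^+ e / pik%:A.
have w0 : w != 0 by rewrite mulf_neq0 ?invr_eq0 ?expf_neq0.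
have vw : vE w = 0.
  by rewrite dvalM ?invr_eq0 ?expf_neq0 // dvalV // dvalX // dvalA // vp va subrr.
have [x [xM hx]] := teichmuller dE cE hsE w0 vw.
have [x0 vx] := root_unity_unit dE qE1_gt0 xM.
exists x; last by rewrite vge_sym.
have h1 : vge vE (w / x - 1) 1.
  rewrite -(mulfV x0) -mulrBl; apply: (vge_divr dE x0 vx).
  by rewrite vge_sym // add0r.
have [t ht h] := one_unit_root dE cE h1 (tame_unit tame).
have [t0 vt] : t != 0 /\ vE t = 0.
  by rewrite -(dval1 dE); apply: dval_close => //; rewrite ?oner_neq0 // dval1.
apply/mu_tameP; split=> //; exists (piE / t), pik; split=> //.
  by split; rewrite ?mulf_neq0 ?invr_eq0 // dvalM ?invr_eq0 // dvalV // vp vt.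
rewrite expr_div_n ht /w; field.
by rewrite a0E x0 expf_neq0.
Qed.

Lemma mu_tame_class x y : mu_tame vk vE e qE x -> mu (qE - 1) y ->
  (mu_tame vk vE e qE y <-> sim_Ek q qE e x y).
Proof.
move=> /mu_tameP[xM [p [a [[p0 vp] [a0 va] hx]]]] yM; rewrite /sim_Ek.
have a0E : a%:A != 0 :> E by rewrite algA_eq0.
have [x0 vx] := root_unity_unit dE qE1_gt0 xM.
have [y0 vy] := root_unity_unit dE qE1_gt0 yM.
split=> [/mu_tameP[_ [p' [a' [[p0' vp'] [a0' va'] hy]]]]|].
  have a0E' : a'%:A != 0 :> E by rewrite algA_eq0.
  have exy : x / y = (p / p') ^+ e * (a' / a)%:A.
    rewrite expr_div_n hx hy algAM algAV; field.
    by rewrite a0E a0E' y0.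
  (* The power of [x / y] is a root of unity; it is 1 as soon as it is a one-unit, which follows
     from x / y = u^e c. *)
  apply: (root_unity_inj dE (natr_card1_unit dE hsE)).
    by rewrite exprAC expr_div_n (xM : x ^+ _ = 1) (yM : y ^+ _ = 1) divr1 expr1n.
  rewrite exy; apply: unit_power_etilde; rewrite ?mulf_neq0 ?invr_eq0 //.
    by rewrite dvalM ?invr_eq0 // dvalV // vp vp'.
  by rewrite dvalM ?invr_eq0 // dvalV // va va'.
case/root_unity_etilde => u [c [u0 vu c0 vc h]].
have c0E : c%:A != 0 :> E by rewrite algA_eq0.
apply/mu_tameP; split=> //; exists (p / u), (a * c).
split; try split; rewrite ?mulf_neq0 ?invr_eq0 //.
- by rewrite dvalM ?invr_eq0 // dvalV // vp vu.
- by rewrite dvalM // va vc.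
have : p ^+ e = y * (u ^+ e * c%:A) * a%:A by rewrite hx -h [y * _]mulrC mulfVK.
rewrite expr_div_n algAM => ->; field.
by rewrite expf_neq0.
Qed.

End LocalExtension.
End Extension.

(** * Choice and linear independence *)

Lemma cid (A : Type) (P : A -> Prop) : (exists x, P x) -> {x | P x}.
Proof. exact: constructive_indefinite_description. Qed.

Lemma ex_last_nat (P : nat -> Prop) (B : nat) :
  P 0%N -> (forall n, P n -> (n <= B)%N) -> exists2 n, P n & ~ P n.+1.
Proof.
move=> P0 hB; apply: NNPP => h.
have hP n : P n by elim: n => // n IH; apply: NNPP => h'; apply: h; exists n.
by have := hB B.+1 (hP _); rewrite ltnn.
Qed.

Section Bases.
Variables (k : fieldType) (E : fieldExtType k).

Definition lin_indep (I : finType) (b : I -> E) : Prop :=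
  forall a : I -> k, \sum_i a i *: b i = 0 -> forall i, a i = 0.

Lemma lin_indep_free (I : finType) (b : I -> E) :
  lin_indep b -> free [tuple b (enum_val i) | i < #|I|].
Proof.
move=> h; apply/freeP => a ha i.
have := h (fun i => a (enum_rank i)) _ (enum_val i); rewrite enum_valK; apply.
rewrite -[RHS]ha [LHS](reindex (@enum_val I I)); last first.
  by exists enum_rank => j _; rewrite ?enum_valK ?enum_rankK.
by apply: eq_bigr => j _; rewrite enum_valK -tnth_nth tnth_mktuple.
Qed.

Lemma lin_indep_dim (I : finType) (b : I -> E) (V : {vspace E}) :
  lin_indep b -> (forall i, b i \in V) ->
  (forall x, x \in V -> exists a, x = \sum_i a i *: b i) -> \dim V = #|I|.
Proof.
move=> h hb hV; set X := [tuple b (enum_val i) | i < #|I|].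
have -> : V = <<X>>%VS.
  apply/eqP; rewrite eqEsubv; apply/andP; split; apply/subvP => x.
    case/hV => a ->; apply: memv_suml => i _; apply: memvZ; apply: memv_span.
    by apply/mapP; exists (enum_rank i); rewrite ?mem_enum ?enum_rankK.
  move: x; apply/subvP/span_subvP => x /mapP[i _ ->]; exact: hb.
by have /eqP -> := lin_indep_free h; rewrite size_tuple.
Qed.

End Bases.

(** * Residually independent families and bases of unramified subfields *)

Section ResidueIndependence.
Variables (k : fieldType) (E : fieldExtType k) (vk : k -> int) (vE : E -> int).
Variables (dk : discrete_valuation vk) (dE : discrete_valuation vE).
Variable e : nat.
Hypothesis ram : ramif_index vk vE e.
Hypothesis ck : v_complete vk.

Let e_gt0 : (0 < e)%N. Proof. by case: ram. Qed.

(** Successive approximation: each remainder gains one in valuation, and the corrections to each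
    coefficient sum to a convergent series in [k]. The bounded loss [e] on the coefficients leaves
    room for basis elements of valuation below [e]. *)
Lemma span_of_approx (I : finType) (b : I -> E) (L : {vspace E}) :
  (forall i, b i \in L) -> (forall i, vge vE (b i) 0) ->
  (forall (x : E) (N : int), x \in L -> vge vE x N -> exists a : I -> k,
     (forall i, vge vE (a i)%:A (N - e%:Z)) /\
     vge vE (x - \sum_i a i *: b i) (N + 1)) ->
  forall x, x \in L -> exists a : I -> k, x = \sum_i a i *: b i.
Proof.
move=> bL ib step x xL; pose N0 := vE x.
(* The approximation is chosen as a total function, with zero coefficients where its hypotheses
   fail, so that it can be iterated. *)
have f_ y N : {a : I -> k | y \in L -> vge vE y N ->
     (forall i, vge vE (a i)%:A (N - e%:Z)) /\
     vge vE (y - \sum_i a i *: b i) (N + 1)}.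
  apply: cid; have [yL|yL] := boolP (y \in L); last by exists (fun=> 0).
  have [hy|hy] := boolP (vge vE y N); last by exists (fun=> 0).
  by have [a ha] := step y N yL hy; exists a.
pose f y N := sval (f_ y N).
pose X n := iteri n (fun m y => y - \sum_i f y (N0 + m%:Z) i *: b i) x.
have hX n : X n \in L /\ vge vE (X n) (N0 + n%:Z).
  elim: n => [|n [h1 h2]]; first by rewrite addr0; split=> //; apply: vge_val.
  have [_ h3] := svalP (f_ (X n) (N0 + n%:Z)) h1 h2; split.
    by rewrite /X /= rpredB // rpred_sum // => i _; rewrite rpredZ.
  by rewrite /X /= -/(X n); have -> : N0 + n.+1%:Z = N0 + n%:Z + 1 by lia.
pose A i n := \sum_(j < n) f (X j) (N0 + j%:Z) i.
have XA n : X n = x - \sum_i A i n *: b i.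
  elim: n => [|n IH].
    by rewrite big1 ?subr0 // => i _; rewrite /A big_ord0 scale0r.
  rewrite /X /= -/(X n) IH -addrA -opprD -big_split /= -IH.
  by congr (_ - _); apply: eq_bigr => i _; rewrite -scalerDl /A big_ord_recr.
have l_ i : {l | v_converges vk (A i) l}.
  apply: cid; apply: complete_cvg => // N.
  exists (absz (e%:Z * N - N0 + e%:Z)) => n hn.
  rewrite {1}/A big_ord_recr /= -/(A i n) addrAC subrr add0r -(vgeA ram).
  have [h1 h2] := hX n; have [h3 _] := svalP (f_ (X n) (N0 + n%:Z)) h1 h2.
  by apply: (vge_trans (h3 i)); lia.
exists (fun i => sval (l_ i)); apply/eqP; rewrite -subr_eq0; apply/eqP.
apply: (@vge_eq0 _ vE) => N.
have M_ i : {M | forall n, (M <= n)%N -> vge vk (A i n - sval (l_ i)) `|N|%N%:Z}.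
  by apply: cid; have [M hM] := svalP (l_ i) `|N|%N%:Z; exists M.
(* Past every convergence threshold [M_ i], and late enough for the remainder [X n] to lie in
   p^N. *)
pose n := (\max_i sval (M_ i) + absz (N - N0))%N.
have -> : x - \sum_i sval (l_ i) *: b i = X n + \sum_i (A i n - sval (l_ i)) *: b i.
  by rewrite XA -addrA; congr (_ + _); rewrite -sumrN -[in RHS]sumrN -big_split /=;
     apply: eq_bigr => i _; rewrite scalerBl addrA addNr add0r.
apply: vgeD => //.
  by apply: (vge_trans (hX n).2); rewrite /n; lia.
apply: vge_sum => // i _; rewrite -mulr_algl -[N]addr0; apply: vgeM => //.
apply: (@vge_trans _ _ _ (e%:Z * `|N|%N%:Z)); last by nia.
rewrite (vgeA ram); apply: (svalP (M_ i)).
apply: leq_trans (leq_addr _ _).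
exact: (@leq_bigmax _ (fun i => sval (M_ i))).
Qed.

(** Linear independence of the residues over the residue field of [k], stated through integral lifts
    of the coefficients. *)
Definition res_indep (I : finType) (b : I -> E) : Prop :=
  (forall i, vge vE (b i) 0) /\
  forall a : I -> k, (forall i, vge vk (a i) 0) ->
    vge vE (\sum_i a i *: b i) 1 -> forall i, vge vk (a i) 1.

Lemma totally_ramified1 : totally_ramified_sub vk vE (1%AS : {subfield E}).
Proof.
move=> x /vlineP[a ->]; rewrite (vgeA0 ram) => ha.
by exists a; rewrite subrr vge0.
Qed.

(** Divide by a coefficient of least valuation. The quotients are integral, hence congruent to
    elements of [k] by total ramification; one quotient is 1, so independence makes the divided sum
    [D] a unit. *)
Lemma res_indep_val (K : {subfield E}) (I : finType) (b : I -> E) (c : I -> E) i1 :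
  totally_ramified_sub vk vE K -> res_indep b ->
  (forall i, c i \in K) -> c i1 != 0 ->
  exists i, [/\ c i != 0, \sum_j c j * b j != 0 & vE (\sum_j c j * b j) = vE (c i)].
Proof.
move=> tr [ib hb] cK c1.
case: (@arg_minP _ _ _ i1 (fun i => c i != 0) (fun i => vE (c i)) c1) => i ci hi.
have id_ j : vge vE (c j / c i) 0.
  have [->|cj] := eqVneq (c j) 0; first by rewrite mul0r vge0.
  by rewrite vgeE ?mulf_neq0 ?invr_eq0 // dvalM ?invr_eq0 // dvalV // subr_ge0 hi.
have a_ j : {a : k | vge vk a 0 /\ vge vE (c j / c i - a%:A) 1}.
  by apply: cid; apply: tr => //; rewrite rpredM // rpredV.
pose a j := sval (a_ j).
have ia j : vge vk (a j) 0 by case: (svalP (a_ j)).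
have ha j : vge vE (c j / c i - (a j)%:A) 1 by case: (svalP (a_ j)).
pose D := \sum_j (c j / c i) * b j.
have hD : vge vE (D - \sum_j a j *: b j) 1.
  rewrite /D -sumrB; apply: vge_sum => // j _; rewrite -mulr_algl -mulrBl.
  by rewrite -[1 : int]addr0; apply: vgeM.
have [D0 vD] : D != 0 /\ vE D = 0.
  apply: vge1_unit.
    apply: vge_sum => // j _; rewrite -[0 : int]addr0; exact: vgeM.
  apply/negP => hD1.
  have := hb a ia; rewrite -(subKr D (\sum_j _)) => /(_ (vgeB dE hD1 hD) i).
  rewrite -(vgeA1 ram) => hai.
  have := vgeD dE (ha i) hai; rewrite subrK divff // vgeE ?oner_eq0 //.
  by rewrite dval1.
exists i; have -> : \sum_j c j * b j = c i * D.
  by rewrite /D mulr_sumr; apply: eq_bigr => j _; rewrite mulrA mulrCA divff ?mulr1.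
by rewrite mulf_neq0 // dvalM // vD addr0.
Qed.

Lemma res_indep_valk (I : finType) (b : I -> E) (c : I -> k) i1 :
  res_indep b -> c i1 != 0 ->
  exists i, [/\ c i != 0, \sum_j c j *: b j != 0
              & vE (\sum_j c j *: b j) = vE (c i)%:A].
Proof.
move=> hb c1.
have cA i : (c i)%:A \in (1%AS : {subfield E}) by rewrite memvZ // mem1v.
have c1A : (c i1)%:A != 0 :> E by rewrite algA_eq0.
have [i []] := res_indep_val totally_ramified1 hb cA c1A.
rewrite algA_eq0 => h1 h2 h3; exists i.
by move: h2 h3; under eq_bigr do rewrite mulr_algl.
Qed.

Lemma res_indep_lin (I : finType) (b : I -> E) : res_indep b -> lin_indep b.
Proof.
move=> hb a ha i; apply/eqP; apply: contraT => ai.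
by have [j []] := res_indep_valk hb ai; rewrite ha eqxx.
Qed.

(** As [U] has the value group of [k], each nonzero [x] can be scaled by an element of [k] to a
    unit, so approximation modulo p_E gives approximation at every level. *)
Lemma res_span_basis (I : finType) (b : I -> E) (U : {subfield E}) :
  unramified_sub vE U -> (forall i, b i \in U) -> (forall i, vge vE (b i) 0) ->
  (forall x, x \in U -> vge vE x 0 -> exists a : I -> k,
     (forall i, vge vk (a i) 0) /\ vge vE (x - \sum_i a i *: b i) 1) ->
  forall x, x \in U -> exists a, x = \sum_i a i *: b i.
Proof.
move=> unr bU ib h; apply: span_of_approx => // x N xU hx.
have [->|x0] := eqVneq x 0.
  exists (fun=> 0); split=> [i|]; first by rewrite scale0r vge0.
  by rewrite big1 ?subr0 ?vge0 // => i _; rewrite scale0r.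
have [c [c0 vc]] := unr x xU x0.
have vNx : N <= vE x by rewrite -vgeE.
have [||a [ia ha]] := h (c^-1 *: x).
- by rewrite memvZ.
- apply: vge_val; rewrite (dvalZ dE ram) ?invr_eq0 // dvalV // vc (dvalA ram) //.
  by rewrite mulrN addNr.
exists (fun i => c * a i); split=> [i|].
  rewrite algAM; apply: (@vge_trans _ _ _ (N + 0)); last by lia.
  apply: vgeM => //; last by rewrite (vgeA0 ram).
  by rewrite vgeE ?algA_eq0 // -vc.
have -> : x - \sum_i (c * a i) *: b i = c%:A * (c^-1 *: x - \sum_i a i *: b i).
  rewrite mulr_algl scalerBr scalerA divff // scale1r scaler_sumr.
  by congr (_ - _); apply: eq_bigr => i _; rewrite scalerA.
by apply: vgeM => //; rewrite vgeE ?algA_eq0 // -vc.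
Qed.

(** A residually independent family in [U] of maximal length exists because such families are
    linearly independent over [k]; by maximality its residues span those of [U]. *)
Lemma unramified_basis (U : {subfield E}) : unramified_sub vE U ->
  exists (n : nat) (b : 'I_n -> E),
    [/\ (forall i, b i \in U), res_indep b &
        forall x, x \in U -> exists a, x = \sum_i a i *: b i].
Proof.
move=> unr.
pose P n := exists b : nat -> E,
  (forall i, b i \in U) /\ res_indep (fun i : 'I_n => b i).
have [||n [b [bU hb]] hn] := @ex_last_nat P (\dim (fullv : {vspace E})).
- exists (fun=> 0); split=> [i|]; first by rewrite mem0v.
  by split=> [[]|a _ _ []].
- move=> n [b [_ /res_indep_lin/lin_indep_free/eqP]].
  by rewrite size_tuple => hd; rewrite -[n]card_ord -hd; apply/dimvS/subvf.
exists n, (fun i => b i); split=> //; apply: res_span_basis => //.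
  by case: hb.
move=> x xU ix; apply: NNPP => hx; apply: hn.
exists (fun i => if (i < n)%N then b i else x); split=> [i|]; first by case: ifP.
case: hb => ib hb; split=> [i|a ia].
  by case: ltnP => // h; apply: (ib (Ordinal h)).
rewrite big_ord_recr /= ltnn; under eq_bigr do rewrite ltn_ord.
move=> hs.
(* If the coefficient of [x] were a unit, solving for [x] would approximate it by the [b i], against
   the choice of [x]. *)
have hmax : vge vk (a ord_max) 1.
  apply: contraT => hm; have [m0 vm] := vge1_unit (ia _) hm; case: hx.
  exists (fun i => - a (widen_ord (leqnSn n) i) / a ord_max); split=> [i|].
    rewrite mulNr vgeN //; apply: (vge_divr dk m0 vm); rewrite addr0; exact: ia.
  have -> : x - \sum_(i < n) (- a (widen_ord (leqnSn n) i) / a ord_max) *: b i =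
    (a ord_max)^-1%:A * (\sum_(i < n) a (widen_ord (leqnSn n) i) *: b i + a ord_max *: x).
    rewrite mulr_algl scalerDr scalerA mulVf // scale1r addrC; congr (_ + _).
    rewrite scaler_sumr -sumrN; apply: eq_bigr => i _.
    by rewrite scalerA -scaleNr; congr (_ *: _); rewrite mulNr opprK mulrC.
  rewrite -[1 : int]add0r; apply: vgeM => //.
  by rewrite (vgeA0 ram); apply: vge_val; rewrite dvalV // vm oppr0.
have hs' : vge vE (\sum_(i < n) a (widen_ord (leqnSn n) i) *: b i) 1.
  rewrite -(addrK (a ord_max *: x) (\sum_(_ < _) _)); apply: vgeB => //.
  by rewrite -mulr_algl -[1 : int]addr0; apply: vgeM => //; rewrite (vgeA1 ram).
move=> i; case: (unliftP ord_max i) => [j|] -> //.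
have := hb (fun i => a (widen_ord (leqnSn n) i)) (fun i => ia _) hs' j.
suff -> : widen_ord (leqnSn n) j = lift ord_max j by [].
by apply: val_inj; rewrite /= /bump leqNgt ltn_ord.
Qed.

(* A uniformizer of E is a combination of residually independent elements of U
   with coefficients in K; its valuation is attained by one of these. *)
Lemma tensor_uniformizer (K U : {subfield E}) :
  totally_ramified_sub vk vE K -> unramified_sub vE U -> (K * U)%VS = fullv ->
  exists2 p, p \in K & uniformizer vE p.
Proof.
move=> tr unr KU; have [n [b [bU hb sp]]] := unramified_basis unr.
have hW : (K * U <= \sum_i (K * <[b i]>))%VS.
  apply/prodvP => x y xK /sp[a ->]; rewrite mulr_sumr; apply: memv_suml => i _.
  rewrite -scalerAr scalerAl; apply: (subvP (sumv_sup i _ (subvv _))) => //.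
  by rewrite memv_mul ?memv_line // memvZ.
case: dE => _ _ [p [p0 vp]].
have : p \in (\sum_i (K * <[b i]>))%VS by rewrite (subvP hW) // KU memvf.
case/memv_sumP => w hw hp.
have c_ i : {c | c \in K /\ w i = c * b i}.
  by apply: cid; have /memv_cosetP[c cK ->] := hw i isT; exists c.
have hpc : p = \sum_i sval (c_ i) * b i.
  by rewrite hp; apply: eq_bigr => i _; case: (svalP (c_ i)).
have [i0 ci0] : exists i, sval (c_ i) != 0.
  apply: NNPP => h; case/eqP: p0; rewrite hpc big1 // => i _.
  by have [->|ci] := eqVneq (sval (c_ i)) 0; [rewrite mul0r|case: h; exists i].
have [i [ci _]] := res_indep_val tr hb (fun i => (svalP (c_ i)).1) ci0.
rewrite -hpc vp => vci; exists (sval (c_ i)); first by case: (svalP (c_ i)).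
by split.
Qed.

(** The unit w = p^e / a of [K] is congruent to some [c] from [k], so w / c is a one-unit t^e, and p
    / t is an e-th root of a c. *)
Lemma totally_tame_root (cE : v_complete vE) (K : {subfield E}) p :
  ~~ vge vE e%:R 1 -> totally_ramified_sub vk vE K -> p \in K -> uniformizer vE p ->
  exists a : k, uniformizer vk a /\ exists y : E, y ^+ e = a%:A.
Proof.
move=> tame tr pK [p0 vp]; case: (dk) => _ _ [a [a0 va]].
have a0E : a%:A != 0 :> E by rewrite algA_eq0.
set w := p ^+ e / a%:A.
have w0 : w != 0 by rewrite mulf_neq0 ?invr_eq0 ?expf_neq0.
have vw : vE w = 0.
  rewrite dvalM ?invr_eq0 ?expf_neq0 // dvalV // dvalX // (dvalA ram) // vp va.
  by lia.
have wK : w \in K by rewrite rpredM ?rpredX // rpredV memvZ ?mem1v.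
have [c [ic hc]] := tr w wK (vge_val vw).
have [c0 vc] : c%:A != 0 :> E /\ vE c%:A = 0.
  by rewrite -vw; apply: dval_close => //; rewrite vw vge_sym.
have h1 : vge vE (w / c%:A - 1) 1.
  have -> : w / c%:A - 1 = (w - c%:A) / c%:A by rewrite mulrBl mulfV.
  by apply: (vge_divr dE c0 vc); rewrite add0r.
have [t ht h] := one_unit_root dE cE h1 tame.
have t0 : t != 0.
  by have [] := @dval_close _ _ dE 1 t (oner_neq0 _); rewrite ?dval1.
exists (a * c); split.
  apply: (uniformizerA ram); rewrite algAM ?mulf_neq0 // dvalM // vc (dvalA ram) //.
  by rewrite va mulr1 addr0.
exists (p / t); rewrite expr_div_n ht algAM /w; field.
by rewrite a0E c0 expf_neq0.
Qed.

End ResidueIndependence.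

(** * Residue field extension and the maximal unramified subfield *)

Lemma adjoin_span (k : fieldType) (E : fieldExtType k) (z : E) (H : {poly k}) n :
  size H = n.+1 -> (map_poly (in_alg E) H).[z] = 0 ->
  forall x, x \in <<1; z>>%VS -> exists a : 'I_n -> k, x = \sum_i a i *: z ^+ i.
Proof.
move=> sH Hz x /Fadjoin1_polyP[P ->].
have H0 : H != 0 by rewrite -size_poly_gt0 sH.
exists (fun i => (P %% H)`_i).
rewrite {1}(divp_eq P H) rmorphD rmorphM /= hornerD hornerM Hz mulr0 add0r.
rewrite (@horner_coef_wide _ n); last first.
  by rewrite size_map_poly -ltnS -sH ltn_modp.
by apply: eq_bigr => i _; rewrite coef_map /= mulr_algl.
Qed.

Lemma ex_min_size (F : fieldType) (P : {poly F} -> Prop) :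
  (exists h, P h) -> exists2 h, P h & forall h', P h' -> (size h <= size h')%N.
Proof.
case=> h; have [n] := ubnP (size h); elim: n h => // n IH h hn Ph.
have [[h' [Ph' lt]]|no] := classic (exists h', P h' /\ (size h' < size h)%N).
  by apply: (IH h') => //; apply: leq_trans lt _.
exists h => // h' Ph'; rewrite leqNgt; apply/negP => lt; apply: no.
by exists h'.
Qed.

Section ResidueExtension.
Variables (k : fieldType) (E : fieldExtType k) (vk : k -> int) (vE : E -> int).
Variables (dk : discrete_valuation vk) (dE : discrete_valuation vE).
Variable e : nat.
Variables (sk : seq k) (hsk : residue_system vk sk).
Variables (sE : seq E) (hsE : residue_system vE sE).
Local Notation resk := (res dk hsk).
Local Notation resE := (res dE hsE).

(** The embedding of residue fields induced by the inclusion of [k] in [E]; the ramification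
    argument lets its morphism structure be inferred. *)
Definition res_ext of ramif_index vk vE e :=
  fun x : residue_field dk hsk => resE (rep x)%:A.

Hypothesis ram : ramif_index vk vE e.
Local Notation iota := (res_ext ram).

Lemma res_extE a : vge vk a 0 -> iota (resk a) = resE a%:A.
Proof.
move=> ha; apply/resP; rewrite ?(vgeA0 ram) ?rep_int //.
by rewrite -scalerBl (vgeA1 ram) vge_sym // rep_res.
Qed.

Fact res_ext_zmod : zmod_morphism iota.
Proof.
move=> x y; rewrite -[x]repK -[y]repK -resN ?rep_int // -resD ?vgeN ?rep_int //.
rewrite !res_extE ?rep_int ?vgeB ?rep_int //.
by rewrite -resN -?resD ?vgeN ?(vgeA0 ram) ?rep_int // scalerBl.
Qed.
HB.instance Definition _ := GRing.isZmodMorphism.Build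
  (residue_field dk hsk) (residue_field dE hsE) iota res_ext_zmod.

Fact res_ext_monoid : monoid_morphism iota.
Proof.
split; first by rewrite -res1 res_extE ?scale1r //; apply: vge_val; apply: dval1.
move=> x y; rewrite -[x]repK -[y]repK -resM ?rep_int //.
rewrite !res_extE ?rep_int //; last by apply: (@rpredM _ (vint dk)); apply: rep_int.
by rewrite -resM ?(vgeA0 ram) ?rep_int // algAM.
Qed.
HB.instance Definition _ := GRing.isMonoidMorphism.Build
  (residue_field dk hsk) (residue_field dE hsE) iota res_ext_monoid.

Lemma res_lincomb n (a : 'I_n -> k) (z : E) :
  (forall i, vge vk (a i) 0) -> vge vE z 0 ->
  resE (\sum_i a i *: z ^+ i) = \sum_i iota (resk (a i)) * resE z ^+ i.
Proof.
move=> ia iz; have iX i : vge vE (z ^+ i) 0 by apply: (@rpredX _ (vint dE)).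
rewrite res_sum; last first.
  by move=> i _; rewrite -mulr_algl; apply: (@rpredM _ (vint dE)); rewrite ?vintE ?(vgeA0 ram).
by apply: eq_bigr => i _; rewrite -mulr_algl resM ?(vgeA0 ram) // resX // res_extE.
Qed.

Lemma res_horner (G : {poly k}) (z : E) :
  (forall i, vge vk G`_i 0) -> vge vE z 0 ->
  resE (map_poly (in_alg E) G).[z] = (map_poly iota (map_poly resk G)).[resE z].
Proof.
move=> iG iz; rewrite (@horner_coef_wide _ (size G)) ?size_map_poly //.
rewrite (@horner_coef_wide _ (size G)); last first.
  by rewrite size_map_poly; apply: size_poly.
under eq_bigr do rewrite coef_map /= mulr_algl.
rewrite res_lincomb //; apply: eq_bigr => i _.
by rewrite coef_map /= coef_map_id0.
Qed.

(* The minimal polynomial over the residue field of k of a generator of the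
   multiplicative group of the residue field of E is separable, so its lifts have
   a root by Hensel; this root generates the maximal unramified subextension. *)
Lemma exists_unramified_sub (ck : v_complete vk) (cE : v_complete vE) :
  exists (U : {subfield E}) (f : nat) (b : 'I_f -> E),
    [/\ unramified_sub vE U, (forall i, b i \in U), res_indep vk vE b,
        (forall x, x \in U -> exists a, x = \sum_i a i *: b i) &
        forall x, vge vE x 0 -> exists a : 'I_f -> k,
          (forall i, vge vk (a i) 0) /\ vge vE (x - \sum_i a i *: b i) 1].
Proof.
have [g hg] := residue_prim_root dE hsE.
set M := (size sE - 1)%N in hg.
have M0 : (0 < M)%N by rewrite subn_gt0 (size_residue_gt1 dE hsE).
have gM := prim_expr_order hg.
have g0 : g != 0.
  by apply/eqP => g0; move/eqP: gM; rewrite g0 expr0n gtn_eqF // eq_sym oner_eq0.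
(* Up to a scalar, [h] is the minimal polynomial of [g] over the residue field of [k]. *)
have [|h [h0 hroot] hmin] := @ex_min_size _
    (fun h : {poly residue_field dk hsk} => h != 0 /\ (map_poly iota h).[g] = 0).
  exists ('X^M - 1); split; first by rewrite -size_poly_eq0 size_XnsubC.
  by rewrite rmorphB rmorph1 /= map_polyXn !hornerE gM subrr.
have hzero (h' : {poly residue_field dk hsk}) :
    (size h' < size h)%N -> (map_poly iota h').[g] = 0 -> h' = 0.
  move=> lt r; apply/eqP; apply: contraLR lt => h'0; rewrite -leqNgt.
  by apply: hmin.
have red (P : {poly residue_field dk hsk}) : (map_poly iota (P %% h)).[g] = (map_poly iota P).[g].
  rewrite [in RHS](divp_eq P h) rmorphD rmorphM /= hornerD hornerM hroot mulr0.
  by rewrite add0r.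
(* By minimality [h] divides X^M - 1, whose derivative M g^(M-1) at [g] is nonzero; so [g] is a
   simple root of [h]. *)
have hsep : (map_poly iota h)^`().[g] != 0.
  have h1 : ('X^M - 1) %% h = 0.
    apply: hzero; first by rewrite ltn_modp.
    by rewrite red rmorphB rmorph1 /= map_polyXn !hornerE gM subrr.
  have /(congr1 (fun p => (map_poly iota p)^`().[g])) := divp_eq ('X^M - 1) h.
  rewrite h1 addr0 rmorphB rmorph1 rmorphM /= map_polyXn derivB derivC subr0 derivXn.
  rewrite derivM hornerD !hornerM hroot mulr0 add0r hornerMn hornerXn => hd.
  apply/eqP => hz; move: hd; rewrite hz mulr0 => /eqP.
  rewrite -mulr_natl mulf_eq0 expf_eq0 (negPf g0) andbF orbF -(res_nat dE hsE).
  rewrite res_eq0; last exact: (@rpred_nat _ (vint dE)).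
  by rewrite (negPf (natr_card1_unit dE hsE)).
pose H := \poly_(i < size h) rep h`_i.
have iH i : vge vk H`_i 0 by rewrite coef_poly; case: ifP; rewrite ?rep_int ?vge0.
have resH : map_poly resk H = h.
  apply/polyP => i; rewrite coef_map_id0 // coef_poly; case: ltnP => [_|le].
    by rewrite repK.
  by rewrite nth_default.
have h_gt0 : (0 < size h)%N by rewrite size_poly_gt0.
have sH : size H = (size h).-1.+1.
  rewrite prednK // size_poly_eq //; apply/eqP => r0.
  have : lead_coef h = 0 by rewrite lead_coefE -[LHS]repK r0.
  by move/eqP; rewrite lead_coef_eq0 (negPf h0).
have resH' : map_poly resk H^`() = h^`().
  apply/polyP => i; rewrite coef_map_id0 // !coef_deriv -resH coef_map_id0 //.
  move: (H`_i.+1) (iH i.+1) => y iy; elim: (i.+1) => // n IH; rewrite !mulrS resD // ?IH //.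
  by apply: (@rpredMn _ (vint dk)).
have iH' i : vge vk H^`()`_i 0 by rewrite coef_deriv; apply: (@rpredMn _ (vint dk)); apply: iH.
have ig := rep_int g.
have ipoly (G : {poly k}) : (forall i, vge vk G`_i 0) ->
    map_poly (in_alg E) G \is a polyOver (vint dE).
  by move=> iG; apply/polyOverP => i; rewrite coef_map /= vintE (vgeA0 ram).
have ihor (G : {poly k}) : (forall i, vge vk G`_i 0) ->
    vge vE (map_poly (in_alg E) G).[rep g] 0.
  by move=> iG; apply: (@rpred_horner _ (vint dE)) => //; apply: ipoly.
have [||||z [hz hzg]] := hensel (dv := dE) cE (F := map_poly (in_alg E) H) (x0 := rep g).
- exact: ipoly.
- exact: ig.
- by rewrite -(res_eq0 dE hsE) ?ihor // res_horner // repK resH hroot.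
- rewrite deriv_map -(res_eq0 dE hsE) ?ihor // res_horner // repK resH'.
  by rewrite -deriv_map.
have iz : vge vE z 0.
  by rewrite -(subrK (rep g) z); apply: vgeD => //; apply: vge_trans hzg _.
have rz : resE z = g by rewrite -[g]repK; apply/resP.
have sp := adjoin_span sH hz.
exists <<1; z>>%AS, (size h).-1, (fun i => z ^+ i).
have ind : res_indep vk vE (fun i : 'I_(size h).-1 => z ^+ i).
  have iX i : vge vE (z ^+ i) 0 by apply: (@rpredX _ (vint dE)).
  split=> // a ia; rewrite -(res_eq0 dE hsE); last first.
    by apply: vge_sum => // i _; rewrite -mulr_algl -[0 : int]addr0; apply: vgeM;
       rewrite ?(vgeA0 ram).
  rewrite res_lincomb // rz => /eqP hs i.
  pose G := rVpoly (\row_i resk (a i)).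
  have sG : (size G <= (size h).-1)%N by apply: size_poly.
  have G0 : G = 0.
    (* A relation among the powers of [g] of degree below that of [h] contradicts minimality unless
       it is trivial. *)
    apply: hzero; first by rewrite (leq_ltn_trans sG) // prednK.
    rewrite (@horner_coef_wide _ (size h).-1) ?size_map_poly // -[RHS]hs.
    by apply: eq_bigr => j _; rewrite coef_map /= coef_rVpoly_ord mxE.
  rewrite -(res_eq0 dk hsk) //; apply/eqP.
  by have := coef_rVpoly_ord (\row_i resk (a i)) i; rewrite -/G G0 coef0 mxE.
split=> //.
- move=> x /sp[a ->] x0.
  have [i ai] : exists i, a i != 0.
    apply: NNPP => no; case/eqP: x0; rewrite big1 // => i _.
    by have [->|ai] := eqVneq (a i) 0; [rewrite scale0r|case: no; exists i].
  by have [j [aj _ ->]] := res_indep_valk dE ram ind ai; exists (a j).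
- by move=> i; rewrite rpredX // memv_adjoin.
move=> x ix.
(* Every nonzero residue is a power of [g]; reduction modulo [h] then bounds the degree. *)
have [Q hQ] : exists Q, resE x = (map_poly iota Q).[g].
  have [->|x0] := eqVneq (resE x) 0; first by exists 0; rewrite rmorph0 horner0.
  have xM : resE x ^+ M = 1.
    apply: (mulfI x0); rewrite -exprS mulr1 /M subn1 prednK.
      by rewrite -(card_residue dE hsE) expf_card.
    exact: ltnW (size_residue_gt1 dE hsE).
  have [i ->] := prim_rootP hg xM; exists 'X^i.
  by rewrite /= map_polyXn hornerXn.
have ia (i : 'I_(size h).-1) : vge vk (rep (Q %% h)`_i) 0 by apply: rep_int.
exists (fun i => rep (Q %% h)`_i); split=> //.
apply/(resP dE hsE) => //.
  by apply: vge_sum => // i _; rewrite -mulr_algl -[0 : int]addr0; apply: vgeM;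
    rewrite ?(vgeA0 ram) //; apply: (@rpredX _ (vint dE)).
rewrite res_lincomb // rz hQ -red (@horner_coef_wide _ (size h).-1).
  by apply: eq_bigr => i _; rewrite coef_map /= repK.
by rewrite size_map_poly -ltnS prednK // ltn_modp.
Qed.

End ResidueExtension.

(** * From a root of a uniformizer to the tensor decomposition *)

Section TensorDecomposition.
Variables (k : fieldType) (E : fieldExtType k) (vk : k -> int) (vE : E -> int).
Variables (dk : discrete_valuation vk) (dE : discrete_valuation vE).
Variable e : nat.
Hypothesis ram : ramif_index vk vE e.

Let e_gt0 : (0 < e)%N. Proof. by case: ram. Qed.

(* The nonzero terms have pairwise distinct valuations modulo e. *)
Lemma vge_unramified_powers (U : {subfield E}) p (u : 'I_e -> E) N :
  unramified_sub vE U -> uniformizer vE p -> (forall j, u j \in U) ->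
  vge vE (\sum_j u j * p ^+ j) N -> forall j, vge vE (u j * p ^+ j) N.
Proof.
move=> unr [p0 vp] uU hS j1.
have [->|uj1] := eqVneq (u j1) 0; first by rewrite mul0r vge0.
pose t j := u j * p ^+ j.
have t0 j : u j != 0 -> t j != 0 by move=> uj; rewrite mulf_neq0 ?expf_neq0.
have vt j : u j != 0 -> exists z : int, vE (t j) = e%:Z * z + j%:Z.
  move=> uj; have [c [c0 vc]] := unr _ (uU j) uj; exists (vk c).
  by rewrite dvalM ?expf_neq0 // vc (dvalA ram) // dvalX // vp mulr1.
case: (@arg_minP _ _ _ j1 (fun j => u j != 0) (fun j => vE (t j)) uj1) => i ui hi.
have hclose : vge vE (\sum_j t j - t i) (vE (t i) + 1).
  rewrite (bigD1 i) //= addrAC subrr add0r; apply: vge_sum => // j ji.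
  have [uj|uj] := eqVneq (u j) 0; first by rewrite /t uj mul0r vge0.
  rewrite vgeE ?t0 // lezD1 lt_neqAle hi // andbT; apply/eqP => eqv.
  case/eqP: ji; apply: val_inj => /=.
  have [zi hzi] := vt i ui; have [zj hzj] := vt j uj.
  rewrite hzi hzj in eqv; have := ltn_ord i; have := ltn_ord j.
  have [lt|lt|ez] := ltrgtP zi zj; last by rewrite ez in eqv; lia.
    by nia.
  by nia.
have [S0 vS] := dval_close dE (t0 _ ui) hclose.
rewrite vgeE -/(t j1) ?t0 //; apply: le_trans (hi _ uj1).
by rewrite -vS -vgeE.
Qed.

Lemma unramified_powers_eq0 (U : {subfield E}) p (u : 'I_e -> E) :
  unramified_sub vE U -> uniformizer vE p -> (forall j, u j \in U) ->
  \sum_j u j * p ^+ j = 0 -> forall j, u j = 0.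
Proof.
move=> unr hp uU h0 j.
have : u j * p ^+ j = 0.
  apply: (@vge_eq0 _ vE) => N.
  by apply: (vge_unramified_powers unr hp uU); rewrite h0 vge0.
by move/eqP; rewrite mulf_eq0 expf_eq0 (negPf hp.1) andbF orbF => /eqP.
Qed.

Lemma unramified1 : unramified_sub vE (1%AS : {subfield E}).
Proof. by move=> x /vlineP[a ->]; rewrite algA_eq0 => a0; exists a. Qed.

Section Root.
Variables (a : k) (p : E).
Hypotheses (ua : uniformizer vk a) (hp : p ^+ e = a%:A).

Lemma root_uniformizer : uniformizer vE p.
Proof.
case: ua => a0 va; have p0 : p != 0.
  apply/eqP => p0; have := algA_eq0 E a; rewrite -hp p0 expr0n gtn_eqF // eqxx.
  by rewrite (negPf a0).
split=> //; have := dvalX dE e p0; rewrite hp (dvalA ram) // va.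
by move/mulfI => <- //; rewrite eqz_nat -lt0n.
Qed.

Lemma root_adjoin_span x : x \in <<1; p>>%VS ->
  exists c : 'I_e -> k, x = \sum_j c j *: p ^+ j.
Proof.
apply: (@adjoin_span _ _ _ ('X^e - a%:P)); first by rewrite size_XnsubC.
by rewrite rmorphB /= map_polyXn map_polyC !hornerE hp /= subrr.
Qed.

Let powA (c : 'I_e -> k) : \sum_j c j *: p ^+ j = \sum_j (c j)%:A * p ^+ j.
Proof. by apply: eq_bigr => j _; rewrite mulr_algl. Qed.

Let memA (c : k) : c%:A \in (1%AS : {subfield E}).
Proof. by rewrite memvZ // mem1v. Qed.

(** Each term c_j p^j of an integral element is itself integral; for 0 < j < e its valuation is not
    divisible by [e], hence positive, so only c_0 survives modulo p_E. *)
Lemma root_totally_ramified : totally_ramified_sub vk vE <<1; p>>%AS.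
Proof.
have [p0 vp] := root_uniformizer.
move=> x /root_adjoin_span[c ->]; rewrite powA => ix.
have ic := vge_unramified_powers unramified1 root_uniformizer (fun j => memA (c j)) ix.
pose j0 := Ordinal e_gt0; exists (c j0); split.
  by have := ic j0; rewrite expr0 mulr1 (vgeA0 ram).
rewrite (bigD1 j0) //= expr0 mulr1 addrAC subrr add0r; apply: vge_sum => // j jj0.
have [->|cj] := eqVneq (c j) 0; first by rewrite scale0r mul0r vge0.
have cjA : (c j)%:A != 0 :> E by rewrite algA_eq0.
have := ic j; rewrite !vgeE ?mulf_neq0 ?expf_neq0 // dvalM ?expf_neq0 //.
rewrite (dvalA ram) // dvalX // vp mulr1.
have : (0 < j)%N by rewrite lt0n; apply: contra jj0 => /eqP h; apply/eqP/val_inj.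
have := ltn_ord j; move: (vk (c j)) (nat_of_ord j) e_gt0 => z i e0 h1 h2.
have [h|h] : 0 <= z \/ z <= -1 by lia.
  by have : 0 <= e%:Z * z; [rewrite mulr_ge0|lia].
by have : e%:Z * z <= e%:Z * -1; [rewrite ler_wpM2l|lia].
Qed.

Lemma root_adjoin_dim : \dim <<1; p>>%VS = e.
Proof.
rewrite -[RHS]card_ord; apply: (@lin_indep_dim _ _ _ (fun j : 'I_e => p ^+ j)).
- move=> c; rewrite powA => /(unramified_powers_eq0 unramified1 root_uniformizer).
  move=> h j; have := h (fun j => memA (c j)) j.
  by move/eqP; rewrite algA_eq0 => /eqP.
- by move=> j; rewrite rpredX // memv_adjoin.
exact: root_adjoin_span.
Qed.

(** Writing vE x = e z + j with j < e, the quotient of [x] by a^z p^j is a unit, which the [b i]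
    approximate; successive approximation does the rest. *)
Lemma unramified_powers_span (ck : v_complete vk) f (b : 'I_f -> E) :
  (forall i, vge vE (b i) 0) ->
  (forall x, vge vE x 0 -> exists c : 'I_f -> k,
     (forall i, vge vk (c i) 0) /\ vge vE (x - \sum_i c i *: b i) 1) ->
  forall x, exists c : 'I_f * 'I_e -> k, x = \sum_ij c ij *: (b ij.1 * p ^+ ij.2).
Proof.
move=> ib hb x; have [p0 vp] := root_uniformizer; have [a0 va] := ua.
have a0E : a%:A != 0 :> E by rewrite algA_eq0.
apply: (@span_of_approx _ _ _ _ dk dE _ ram ck _ _ fullv); rewrite ?memvf //.
- by move=> ij; rewrite memvf.
- move=> ij; rewrite -[0 : int]addr0; apply: vgeM => //.
  by rewrite vgeE ?expf_neq0 // dvalX // vp mulr1.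
move=> {}x N _ hx.
have [->|x0] := eqVneq x 0.
  exists (fun=> 0); split=> [i|]; first by rewrite scale0r vge0.
  by rewrite big1 ?subr0 ?vge0 // => i _; rewrite scale0r.
rewrite vgeE // in hx.
pose z := (vE x %/ e%:Z)%Z.
have e0 : e%:Z != 0 by rewrite eqz_nat -lt0n.
have lt_r : (`|(vE x %% e%:Z)%Z| < e)%N.
  by have := @ltz_pmod (vE x) e%:Z; have := @modz_ge0 (vE x) e%:Z e0; lia.
pose j := Ordinal lt_r.
have hv : vE x = e%:Z * z + j%:Z.
  by rewrite {1}(divz_eq (vE x) e%:Z) mulrC /= gez0_abs // modz_ge0.
pose w := (a ^ z)%:A * p ^+ j.
have az0 : a ^ z != 0 by rewrite expfz_neq0.
have w0 : w != 0 by rewrite mulf_neq0 ?algA_eq0 ?expf_neq0.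
have vw : vE w = vE x.
  rewrite dvalM ?algA_eq0 ?expf_neq0 // (dvalA ram) // dvalXz // dvalX // va vp.
  by rewrite !mulr1 hv.
have [|c [ic hc]] := hb (x / w).
  by apply: vge_val; rewrite dvalM ?invr_eq0 // dvalV // vw subrr.
exists (fun ij => if ij.2 == j then a ^ z * c ij.1 else 0); split=> [ij|].
  case: ifP => _; last by rewrite scale0r vge0.
  (* The coefficients have valuation at least e z = vE x - j, which exceeds N - e because j < e. *)
  rewrite algAM; apply: (@vge_trans _ _ _ (e%:Z * z + 0)).
    by apply: vgeM; rewrite ?(vgeA0 ram) // (vgeA ram); apply: vge_val; rewrite dvalXz // va mulr1.
  by have := ltn_ord j; lia.
have -> : \sum_ij (if ij.2 == j then a ^ z * c ij.1 else 0) *: (b ij.1 * p ^+ ij.2) =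
    w * \sum_i c i *: b i.
  rewrite -(pair_bigA _ (fun i j' => (if j' == j then a ^ z * c i else 0) *:
    (b i * p ^+ j'))) /= mulr_sumr; apply: eq_bigr => i _.
  rewrite (bigD1 j) //= eqxx big1 ?addr0 => [|j' /negPf ->]; last by rewrite scale0r.
  by rewrite /w mulr_algl -scalerAr -scalerAl scalerA [c i * _]mulrC [_ * b i]mulrC.
have -> : x - w * \sum_i c i *: b i = w * (x / w - \sum_i c i *: b i).
  by rewrite mulrBr [w * (x / w)]mulrC divfK.
by apply: vgeM => //; rewrite vgeE // vw.
Qed.

Lemma root_tensor_decomposition (ck : v_complete vk) (cE : v_complete vE)
    (sk : seq k) (hsk : residue_system vk sk)
    (sE : seq E) (hsE : residue_system vE sE) :
  exists K U : {subfield E},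
    [/\ totally_ramified_sub vk vE K, unramified_sub vE U & tensor_decomposition K U].
Proof.
have [U [f [b [unr bU ind sp hb]]]] := exists_unramified_sub dk dE hsk hsE ram ck cE.
exists <<1; p>>%AS, U; split=> //; first exact: root_totally_ramified.
have spE := unramified_powers_span ck ind.1 hb.
have dU : \dim U = f.
  by rewrite (lin_indep_dim (res_indep_lin dE ram ind) bU sp) card_ord.
split.
  apply/eqP; rewrite eqEsubv subvf; apply/subvP => x _.
  have [c ->] := spE x; apply: memv_suml => ij _; rewrite memvZ // mulrC memv_mul //.
  by rewrite rpredX // memv_adjoin.
rewrite root_adjoin_dim dU.
rewrite (@lin_indep_dim _ _ _ (fun ij : 'I_f * 'I_e => b ij.1 * p ^+ ij.2)).
- by rewrite card_prod !card_ord mulnC.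
(* Independence in two stages: grouping by powers of [p] gives coefficients in [U], which all
   vanish, and each of these is a combination of the independent [b i]. *)
- move=> c hc [i j] /=.
  have uU j' : \sum_i' c (i', j') *: b i' \in U.
    by rewrite rpred_sum // => i' _; rewrite rpredZ.
  apply: (res_indep_lin dE ram ind) (fun i => c (i, j)) _ i.
  apply: (unramified_powers_eq0 unr root_uniformizer uU) j; rewrite -[RHS]hc.
  rewrite [RHS](eq_bigr (fun ij => c (ij.1, ij.2) *: (b ij.1 * p ^+ ij.2))); last by case.
  rewrite -(pair_bigA _ (fun i j => c (i, j) *: (b i * p ^+ j))) exchange_big /=.
  apply: eq_bigr => j' _; rewrite mulr_suml.
  by apply: eq_bigr => i' _; rewrite scalerAl.
- by move=> ij; rewrite memvf.
- by move=> x _; apply: spE.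
Qed.

End Root.
End TensorDecomposition.

(** * Assembly of the equivalences *)

Theorem mainTheorem16 (k : fieldType) (E : fieldExtType k)
    (vk : k -> int) (vE : E -> int) (q qE e : nat) :
  nonarch_local_field vk q ->
  nonarch_local_field vE qE ->
  ramif_index vk vE e ->
  tamely_ramified vk e ->
  (exists x : E, mu_tame vk vE e qE x /\
     forall y : E, mu (qE - 1) y -> (mu_tame vk vE e qE y <-> sim_Ek q qE e x y)) /\
  [<-> (exists K U : {subfield E},
          [/\ totally_ramified_sub vk vE K, unramified_sub vE U
            & tensor_decomposition K U]);
       (exists a : k, uniformizer vk a /\ exists y : E, y ^+ e = a%:A);
       mu_tame vk vE e qE 1;
       (exists (piE : E) (pik : k), [/\ uniformizer vE piE, uniformizer vk pik &
          vge vE ((piE ^+ e / pik%:A) ^+ ((qE - 1) %/ etilde q qE e) - 1) 1]);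
       (forall (piE : E) (pik : k), uniformizer vE piE -> uniformizer vk pik ->
          vge vE ((piE ^+ e / pik%:A) ^+ ((qE - 1) %/ etilde q qE e) - 1) 1)].
Proof.
move=> [dk ck [sk [<- ik jk lk]]] [dE cE [sE [<- iE jE lE]]] ram tame.
have hsk : residue_system vk sk by split.
have hsE : residue_system vE sE by split.
have [pE uE] : exists p, uniformizer vE p by case: (dE).
have [pk uk] : exists p, uniformizer vk p by case: (dk).
have e_gt0 : (0 < e)%N by case: ram.
have qE1_gt0 : (0 < size sE - 1)%N by rewrite subn_gt0 (size_residue_gt1 dE hsE).
have approx := mu_tame_approx dk dE ram cE hsk hsE tame.
have class := mu_tame_class dk dE ram ck cE hsk hsE.
have mu1 : mu (size sE - 1) (1 : E) by rewrite /mu expr1n.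
(* Some [x] in [mu_tame] has the same residue as p^e / a. Its power is then a root of unity and a
   one-unit, so it is 1, that is, [x] is equivalent to 1. *)
have sim1 (p : E) (a : k) : uniformizer vE p -> uniformizer vk a ->
    vge vE ((p ^+ e / a%:A) ^+ ((size sE - 1) %/ etilde (size sk) (size sE) e) - 1) 1 ->
    mu_tame vk vE e (size sE) 1.
  move=> up ua h; have [x hx hpx] := approx p a up ua.
  apply/(class _ _ hx mu1); rewrite /sim_Ek divr1.
  set m := (_ %/ _)%N in h *.
  have [x0 vx] := root_unity_unit dE qE1_gt0 hx.1.
  apply: (root_unity_inj dE (natr_card1_unit dE hsE)).
    by rewrite exprAC (hx.1 : x ^+ _ = 1) expr1n.
  have ix : vge vE x 0 by apply: vge_val.
  have iw : vge vE (p ^+ e / a%:A) 0.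
    rewrite -(subrK x (p ^+ e / _)); apply: vgeD => //.
    exact: vge_trans hpx _.
  have eqr : res dE hsE (p ^+ e / a%:A) = res dE hsE x by apply/resP.
  rewrite -(res_eq1 dE hsE) ?resX -?eqr -?resX ?res_eq1 //.
    by apply: (@rpredX _ (vint dE)).
  by apply: (@rpredX _ (vint dE)).
(* With p^e = a for one pair of uniformizers, the quotient for any other pair has the form u^e c
   with units [u] of [E] and [c] of [k]. *)
have all1 : mu_tame vk vE e (size sE) 1 -> forall (piE : E) (pik : k),
    uniformizer vE piE -> uniformizer vk pik ->
    vge vE ((piE ^+ e / pik%:A) ^+ ((size sE - 1) %/ etilde (size sk) (size sE) e) - 1) 1.
  move=> /(mu_tameP dE ram hsE)[_ [p [a [[p0 vp] [a0 va] hp]]]] p' a' [p0' vp'] [a0' va'].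
  have a0E : a%:A != 0 :> E by rewrite algA_eq0.
  have a0E' : a'%:A != 0 :> E by rewrite algA_eq0.
  have -> : p' ^+ e / a'%:A = (p' / p) ^+ e * (a / a')%:A.
    by rewrite expr_div_n hp algAM algAV; field; rewrite a0E a0E'.
  apply: (unit_power_etilde dk dE ram ck hsk hsE); rewrite ?mulf_neq0 ?invr_eq0 //.
    by rewrite dvalM ?invr_eq0 // dvalV // vp vp'.
  by rewrite dvalM ?invr_eq0 // dvalV // va va'.
split.
  have [x hx _] := approx pE pk uE uk; exists x; split=> // y hy.
  exact: class.
tfae.
- case=> K [U [tr unr [KU _]]].
  have [p pK up] := tensor_uniformizer dk dE ram ck tr unr KU.
  exact: (totally_tame_root dk dE ram cE (tame_unit dk ram hsk tame) tr pK up).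
- case=> a [ua [p hp]]; apply/(mu_tameP dE ram hsE); split=> //.
  by exists p, a; split=> //; [apply: (root_uniformizer dE ram ua hp)|rewrite mul1r].
- by move=> /all1 h; exists pE, pk; split=> //; apply: h.
- by case=> p [a [up ua /(sim1 _ _ up ua)/all1]].
(* The cycle closes through 1 in [mu_tame], which yields a root of a uniformizer of [k] and with it
   the decomposition. *)
- move=> h5; have := sim1 _ _ uE uk (h5 _ _ uE uk).
  case/(mu_tameP dE ram hsE) => _ [p [a [up ua hp]]].
  rewrite mul1r in hp.
  exact: (root_tensor_decomposition dk dE ram ua hp ck cE hsk hsE).
Qed.
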